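(* Assume Assumptions A.1–A.3. Suppose there exist nonnegative constants $c_1,\dots,c_p$ with $\sum_{i=1}^p c_i<1$, a constant $r>0$ and $K<\infty$ such that $$E(|\xi_1|^r\mid X_0=x)\le K+\sum_{i=1}^p c_i|x_i|^r\qquad\text{for all }x=(x_1,\dots,x_p)\in\mathbb{R}^p.$$ Then there exist positive constants $d_1,\dots,d_p$ such that $\{X_t\}$ is $V$-uniformly ergodic with $V(x)=1+\sum_{i=1}^p d_i|x_i|^r$. Furthermore, the stationary distribution of $\{X_t\}$ has finite $r$th moment.
   Context: Model: $\xi_t=a(\xi_{t-1},\dots,\xi_{t-p})+b(\xi_{t-1},\dots,\xi_{t-p})e_t$, where $a,b:\mathbb{R}^p\to\mathbb{R}$ are measurable (finitely piecewise continuous) functions, $\{e_t\}_{t\ge1}$ is an i.i.d. sequence independent of the initial state, and $X_t=(\xi_t,\dots,\xi_{t-p+1})\in\mathbb{R}^p$ is the associated Markov chain. $\|\cdot\|$ is the Euclidean norm. Assumption A.1: $e_t$ has a Lebesgue density $f$ which is locally bounded away from $0$ (bounded below by a positive constant on each compact set); $b$ is positive, locally bounded and locally bounded away from $0$. Assumption A.2: $\sup_{u\in\mathbb{R}}(1+|u|)f(u)<\infty$ and $E(|e_1|^{r_0})<\infty$ for some $r_0>0$. Assumption A.3: $a(x)/(1+\|x\|)$ and $b(x)/(1+\|x\|)$ are bounded on $\mathbb{R}^p$. For a function $V\ge1$, the chain is called $V$-uniformly ergodic if it has a stationary distribution $\Gamma$ and there exist $M<\infty$, $\beta<1$ with $\sup_{|g|\le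 V}|E(g(X_n)\mid X_0=x)-\int g\,d\Gamma|\le M\beta^nV(x)$ for all $n$ and $x$ (in particular $\sup_A|P(X_n\in A\mid X_0=x)-\Gamma(A)|\le M\beta^nV(x)$). *)

(* Defs.v *)
From HB Require Import structures.
From mathcomp Require Import all_boot all_order all_algebra.
From mathcomp Require Import all_classical all_reals all_analysis.
Set Implicit Arguments. Unset Strict Implicit. Unset Printing Implicit Defensive.
Import Order.TTheory GRing.Theory Num.Theory.
Import numFieldNormedType.Exports.
Local Open Scope classical_set_scope.
Local Open Scope ring_scope.

Section Defs.
Variables (R : realType) (p : nat).

(* state space R^p, represented by row vectors; x ord0 i is the i-th coordinate
   (i = 0 corresponds to x_1 = xi_t, the most recent value) *)
Notation vec := 'rV[R]_p.

(* Borel sigma-algebra on R^p: generated by the coordinate projections *)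
Definition coord_sets : set (set vec) :=
  [set A | exists (i : 'I_p) (B : set R), measurable B /\
                                         A = (fun x : vec => x ord0 i) @^-1` B].

Definition Rp := g_sigma_algebraType coord_sets.

Definition enorm (x : vec) : R := Num.sqrt (\sum_(i < p) x ord0 i ^+ 2).

Definition piecewise_continuous (h : vec -> R) : Prop :=
  exists s : seq (set vec),
    (forall A, A \in s -> measurable (A : set Rp)) /\
    (forall x : vec, exists2 A, A \in s & A x) /\
    (forall A, A \in s -> {within A, continuous h}).

(* one step of the chain: X_{t} = (a(X_{t-1}) + b(X_{t-1}) e_t, xi_{t-1}, ..., xi_{t-p+1}) *)
Definition next (a b : vec -> R) (x : vec) (u : R) : vec :=
  \row_(i < p) (if (i : nat) == 0%N then a x + b x * u
                else x ord0 (insubd i (i : nat).-1)).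

(* E(g(X_n) | X_0 = x), where e_1, e_2, ... are i.i.d. with law mu and
   independent of X_0; computed via the Markov property *)
Fixpoint cexp (mu : probability R R) (a b : vec -> R) (n : nat) (g : vec -> R)
  (x : vec) : \bar R :=
  match n with
  | 0%N => (g x)%:E
  | n'.+1 => (\int[mu]_u cexp mu a b n' g (next a b x u))%E
  end.

Definition stationary (mu : probability R R) (a b : vec -> R)
  (Gamma : probability Rp R) : Prop :=
  forall A : set Rp, measurable A ->
    (\int[Gamma]_x cexp mu a b 1 (fun y => (\1_A y : R)) x)%E = Gamma A.

Definition V_uniformly_ergodic_with (mu : probability R R) (a b : vec -> R)
  (V : vec -> R) (Gamma : probability Rp R) : Prop :=
  stationary mu a b Gamma /\
  exists (M beta : R), beta < 1 /\
    forall (g : vec -> R), measurable_fun [set: Rp] (g : Rp -> R) ->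
      (forall x, `|g x| <= V x) ->
      forall (n : nat) (x : vec),
        (`| cexp mu a b n g x - \int[Gamma]_y (g y)%:E | <=
           (M * beta ^+ n * V x)%:E)%E.

Definition V_uniformly_ergodic (mu : probability R R) (a b : vec -> R)
  (V : vec -> R) : Prop :=
  exists Gamma : probability Rp R, V_uniformly_ergodic_with mu a b V Gamma.

End Defs.

(* Main.v *)
From Pilot Require Import Defs.
From HB Require Import structures.
From mathcomp Require Import all_boot all_order all_algebra.
From mathcomp Require Import all_classical all_reals all_analysis.
From mathcomp Require Import measurable_realfun ring lra.
Set Implicit Arguments.
Unset Strict Implicit.
Unset Printing Implicit Defensive.
Import Order.TTheory GRing.Theory Num.Theory.
Import numFieldNormedType.Exports.
Local Open Scope classical_set_scope.
Local Open Scope ring_scope.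

(* Harris' theorem in the Hairer-Mattingly form. With weights d_i decreasing from
   d_1 = 1 so that d_i - d_(i+1) = c_i + e, where e = (1 - sum c) / p, the drift
   condition becomes the geometric drift P V <= (1 - e) V + K'. On sets where V is
   bounded, each step of the chain dominates a multiple of a step that inserts a
   uniform [0, 1] coordinate, because the density of the noise and the scale b are
   locally bounded away from 0 and a is locally bounded; after p steps all the old
   coordinates are gone, so P^p dominates a fixed measure. Drift and minorization
   make P^p a strict contraction for the seminorm
   sup |g x - g y| / (2 + be (V x + V y)). The laws of X_n are then Cauchy in total
   variation; their limit is stationary, integrates V, and attracts at a geometric
   rate. *)

(** * Contraction in a weighted oscillation norm *)

Section WeightedFunctions.
Context {d} {T : measurableType d} {R : realType} (W : T -> R).

(** A single step cannot be minorized when [p >= 2]: it keeps all but one of the old coordinates, so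
    the laws started from states with different first coordinates are mutually singular. Hence the
    passage to [p] steps. In between, the true chain may jump arbitrarily far, where no uniform
    constant is available; the inserted coordinate is taken uniform on a bounded interval precisely
    so that the intermediate states stay in a box fixed in advance.

    Total variation does not control the unbounded weight, whose integrability is recovered by
    truncation.

    The contraction is stated for real functionals on weight-bounded functions, so that iterates of
    the transition operator and the minorizing measure fall under one notion and no kernel
    composition is needed. *)

Definition wbounded (g : T -> R) : Prop :=
  measurable_fun [set: T] g /\ exists C, forall x, `|g x| <= C * W x.

(* Stands for integration against a probability measure that integrates [W];
   the contraction argument uses nothing else. *)
Definition markov_functional (l : (T -> R) -> R) : Prop :=
  [/\ forall g h c, wbounded g -> wbounded h ->
        l (fun x => g x + c * h x) = l g + c * l h,
      forall g, wbounded g -> (forall x, 0 <= g x) -> 0 <= l g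
    & l (fun=> 1) = 1].

Definition markov_operator (P : (T -> R) -> T -> R) : Prop :=
  (forall g, wbounded g -> wbounded (P g)) /\
  forall x, markov_functional (fun g => P g x).

Hypotheses (mW : measurable_fun [set: T] W) (W1 : forall x, 1 <= W x).

Lemma wbounded_weight : wbounded W.
Proof.
split => //; exists 1 => x; rewrite mul1r ger0_norm//.
exact: le_trans ler01 (W1 x).
Qed.

Lemma wbounded_cst c : wbounded (fun=> c).
Proof.
split; first exact: measurable_cst.
by exists `|c| => x; rewrite ler_peMr.
Qed.

Lemma wboundedDZ g h c : wbounded g -> wbounded h ->
  wbounded (fun x => g x + c * h x).
Proof.
move=> [mg [C gC]] [mh [D hD]]; split.
  by apply: measurable_funD => //; apply: measurable_funM.
exists (C + `|c| * D) => x; rewrite mulrDl.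
apply: (le_trans (ler_normD _ _)); apply: lerD => //.
by rewrite normrM -mulrA ler_wpM2l.
Qed.

Lemma wboundedZ g c : wbounded g -> wbounded (fun x => c * g x).
Proof.
move=> gW; have := wboundedDZ c (wbounded_cst 0) gW.
by under eq_fun do rewrite add0r.
Qed.

Section Functional.
Context (l : (T -> R) -> R) (lM : markov_functional l).

Lemma markovDZ g h c : wbounded g -> wbounded h ->
  l (fun x => g x + c * h x) = l g + c * l h.
Proof. by case: lM => + _ _; apply. Qed.

Lemma markov_cst c : l (fun=> c) = c.
Proof.
case: (lM) => _ _ l1.
have -> : (fun=> c) = (fun x : T => 1 + (c - 1) * 1).
  by apply/funext => x; rewrite mulr1 subrKC.
by rewrite markovDZ ?l1 ?mulr1 ?subrKC//; exact: wbounded_cst.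
Qed.

Lemma markovZ g c : wbounded g -> l (fun x => c * g x) = c * l g.
Proof.
move=> gW; have := markovDZ c (wbounded_cst 0) gW.
by under eq_fun do rewrite add0r; rewrite markov_cst add0r.
Qed.

Lemma markov_le g h : wbounded g -> wbounded h -> (forall x, g x <= h x) ->
  l g <= l h.
Proof.
move=> gW hW gh; case: (lM) => _ l0 _.
rewrite -subr_ge0 -mulN1r -markovDZ//; apply: l0; first exact: wboundedDZ.
by move=> x; rewrite mulN1r subr_ge0.
Qed.

Lemma markov_norm_le g h : wbounded g -> wbounded h ->
  (forall x, `|g x| <= h x) -> `|l g| <= l h.
Proof.
move=> gW hW gh; rewrite ler_norml; apply/andP; split; last first.
  by apply: markov_le => // x; exact: le_trans (ler_norm _) (gh x).
rewrite -mulN1r -markovZ//; apply: markov_le => //; first exact: wboundedZ.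
by move=> x; rewrite mulN1r lerNl; apply: le_trans (gh x); rewrite -normrN ler_norm.
Qed.

(** Turns a comparison of two starting points into a comparison of a starting point with a starting
    law, by averaging the bound over the second point. *)
Lemma markov_dist_le g (a c e : R) : wbounded g ->
  (forall y, `|a - g y| <= c * (e + W y)) -> `|a - l g| <= c * (e + l W).
Proof.
move=> gW age.
have -> : a - l g = l (fun y => a + (-1) * g y).
  by rewrite markovDZ ?markov_cst ?mulN1r//; exact: wbounded_cst.
have -> : c * (e + l W) = l (fun y => c * e + c * W y).
  rewrite markovDZ ?markov_cst ?mulrDr//; first exact: wbounded_cst.
  exact: wbounded_weight.
apply: markov_norm_le => [||y].
- by apply: wboundedDZ => //; exact: wbounded_cst.
- by apply: wboundedDZ; [exact: wbounded_cst|exact: wbounded_weight].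
- by rewrite mulN1r -mulrDr.
Qed.

End Functional.

Lemma markov_functional_comp l P : markov_functional l -> markov_operator P ->
  markov_functional (fun g => l (P g)).
Proof.
move=> lM [PW PM]; split => [g h c gW hW|g gW g0|].
- rewrite -markovDZ; [|exact: lM|exact: PW|exact: PW].
  by congr l; apply/funext => x; rewrite (markovDZ (PM x)).
- case: lM => _ + _; apply; first exact: PW.
  by move=> x; case: (PM x) => _ + _; apply.
- rewrite -[RHS](markov_cst lM); congr l; apply/funext => x.
  by rewrite (markov_cst (PM x)).
Qed.

Lemma markov_operator_iter P n : markov_operator P -> markov_operator (iter n P).
Proof.
move=> PM; elim: n => [|n [IHW IHM]].
  by split => // x; split => //.
split => [g gW|x]; first by rewrite iterS; apply: PM.1; exact: IHW.
have := markov_functional_comp (PM.2 x) (conj IHW IHM).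
by under eq_fun do rewrite -iterS.
Qed.

(** [K / (1 - gam)] is the fixed point of the map sending [t] to [K + gam * t], so the additive
    constant does not grow with [n]. *)
Lemma markov_operator_iter_drift P (gam K : R) n : markov_operator P ->
  0 <= gam < 1 -> (forall x, P W x <= gam * W x + K) -> 0 <= K ->
  forall x, iter n P W x <= gam ^+ n * W x + K / (1 - gam).
Proof.
move=> PM /andP[gam0 gam1] PK K0; elim: n => [|n IH] x.
  by rewrite expr0 mul1r lerDl divr_ge0// subr_ge0 ltW.
rewrite iterSr.
have [nW nM] := markov_operator_iter n PM.
have WW := wbounded_weight; have cW := wbounded_cst K.
apply: (@le_trans _ _ (iter n P (fun x => K + gam * W x) x)).
  apply: (markov_le (nM x)); [exact: PM.1|exact: wboundedDZ|].
  by move=> y; rewrite addrC.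
rewrite (markovDZ (nM x))// (markov_cst (nM x)).
apply: (@le_trans _ _ (K + gam * (gam ^+ n * W x + K / (1 - gam)))).
  by rewrite lerD2l ler_wpM2l.
rewrite exprS le_eqVlt; apply/orP; left; apply/eqP; field.
by rewrite subr_eq0 gt_eqF.
Qed.

(* Subtracting the constant [c = sup (g - 1 - be W)] from [g]. *)
Lemma oscillation_shift (g : T -> R) (be : R) :
  (forall x y, `|g x - g y| <= 2 + be * (W x + W y)) ->
  exists c, forall x, `|g x - c| <= 1 + be * W x.
Proof.
move=> gosc.
have gle x y : g x - (1 + be * W x) <= g y + (1 + be * W y).
  by have := le_trans (ler_norm _) (gosc x y); rewrite mulrDr; lra.
pose S := range (fun x => g x - (1 + be * W x)).
have [x0 _] : [set: T] !=set0 by exists point.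
have Sub : has_ubound S.
  by exists (g x0 + (1 + be * W x0)) => _ [y _ <-]; exact: gle.
exists (sup S) => x; rewrite ler_norml; apply/andP; split.
  suff : sup S <= g x + (1 + be * W x) by lra.
  apply: ge_sup; first by exists (g x0 - (1 + be * W x0)); exists x0.
  by move=> _ [y _ <-]; exact: gle.
suff : g x - (1 + be * W x) <= sup S by lra.
by apply: ub_le_sup => //; exists x.
Qed.

(** If one of the two points lies outside [W <= R0], the drift alone shrinks the bound; if both lie
    inside, the common part [al * nu h] cancels in the difference. The factor [be] must be small
    enough that the constant [K] of the drift does not consume this gain. *)
Lemma harris_contraction (Q : (T -> R) -> T -> R) (nu : (T -> R) -> R)
    (gam K al R0 : R) :
  markov_operator Q -> markov_functional nu ->
  0 <= gam < 1 -> 0 <= K -> 0 < al <= 1 -> 2 * K < (1 - gam) * R0 ->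
  (forall x, Q W x <= gam * W x + K) ->
  (forall x g, W x <= R0 -> wbounded g -> (forall y, 0 <= g y) ->
     al * nu g <= Q g x) ->
  exists be kap, [/\ 0 < be, 0 < kap < 1 &
    forall g (M : R), 0 < M -> wbounded g ->
      (forall x y, `|g x - g y| <= M * (2 + be * (W x + W y))) ->
      forall x y, `|Q g x - Q g y| <= kap * M * (2 + be * (W x + W y))].
Proof.
move=> QM nuM /andP[gam0 gam1] K0 /andP[al0 al1] KR0 QK Qmin.
have R0_gt0 : 0 < R0 by nra.
(* For two points in the small set the minorization gains [2 * al] and the drift costs
   [2 * (be * K) <= al], which leaves at least [al]. The [+ 1] covers [K = 0]. *)
pose be := al / (2 * K + 1).
have be0 : 0 < be by rewrite divr_gt0//; lra.
have beK : 2 * (be * K) <= al.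
  have : be * (2 * K + 1) = al by rewrite divfK//; lra.
  by nra.
(* The first entry serves pairs inside the small set, the last one the remaining pairs; [1 - gam]
   bounds the slope in [W x + W y] in both cases. *)
pose eta := Num.min (al / 2) (Num.min (1 - gam)
  (be * ((1 - gam) * R0 - 2 * K) / (2 + be * R0))).
have D0 : 0 < 2 + be * R0 by rewrite addr_gt0// mulr_gt0.
have eta0 : 0 < eta.
  rewrite !lt_min; apply/and3P; split; [lra|lra|].
  by rewrite divr_gt0// mulr_gt0//; lra.
have eta1 : eta <= al / 2 by rewrite ge_min lexx.
have eta2 : eta <= 1 - gam by rewrite !ge_min lexx orbT.
have eta3 : eta * (2 + be * R0) <= be * ((1 - gam) * R0 - 2 * K).
  by rewrite -ler_pdivlMr// !ge_min lexx !orbT.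
clearbody eta.
exists be, (1 - eta); split => //; first by lra.
suff main g : wbounded g ->
    (forall x y, `|g x - g y| <= 2 + be * (W x + W y)) ->
    forall x y, `|Q g x - Q g y| <= (1 - eta) * (2 + be * (W x + W y)).
  move=> g M M0 gW gosc x y.
  have := main (fun x => M^-1 * g x) (wboundedZ M^-1 gW) _ x y.
  rewrite !(markovZ (QM.2 _))// -mulrBr normrM gtr0_norm ?invr_gt0//.
  rewrite mulrC ler_pdivrMr// [_ * M]mulrAC; apply => {}x {}y.
  rewrite -mulrBr normrM gtr0_norm ?invr_gt0//.
  by rewrite mulrC ler_pdivrMr// mulrC.
move=> gW0 gosc x y.
have [c gc] := oscillation_shift gosc.
pose h x := g x + (- c) * 1.
have hW : wbounded h by apply: wboundedDZ => //; exact: wbounded_cst.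
have hle z : `|h z| <= 1 + be * W z by rewrite /h mulr1.
have -> : Q g x - Q g y = Q h x - Q h y.
  rewrite !(markovDZ (QM.2 _))//; try exact: wbounded_cst.
  by rewrite !(markov_cst (QM.2 _)); ring.
pose w z := 1 + be * W z.
have wW : wbounded w.
  by apply: wboundedDZ; [exact: wbounded_cst|exact: wbounded_weight].
have Qw z : Q w z <= 1 + be * (gam * W z + K).
  rewrite (markovDZ (QM.2 _)) ?(markov_cst (QM.2 _)) ?lerD2l.
  - by rewrite ler_wpM2l// ltW.
  - exact: wbounded_cst.
  - exact: wbounded_weight.
have Wx1 := W1 x; have Wy1 := W1 y.
set S := W x + W y.
have [/andP[Wx Wy]|far] := boolP ((W x <= R0) && (W y <= R0)); last first.
  have SR0 : R0 <= S.
    by move: far; rewrite negb_and -!ltNge /S => /orP[]; lra.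
  have bQ z : `|Q h z| <= 1 + be * (gam * W z + K).
    exact: le_trans (markov_norm_le (QM.2 z) hW wW hle) (Qw z).
  apply: (le_trans (ler_normB _ _)); apply: (le_trans (lerD (bQ x) (bQ y))).
  (* Both sides are affine in [S]: the inequality at [S = R0] is [eta3], and the slopes compare by
     [eta2]. *)
  have : eta * (2 + be * S) <= be * ((1 - gam) * S - 2 * K).
    have : eta * (be * (S - R0)) <= (1 - gam) * (be * (S - R0)).
      by rewrite ler_wpM2r// mulr_ge0 ?subr_ge0// ltW.
    by lra.
  by rewrite /S; lra.
have nw : 1 <= nu w.
  rewrite -[leLHS](markov_cst nuM); apply: (markov_le nuM) => //.
    exact: wbounded_cst.
  by move=> z; rewrite lerDl mulr_ge0 ?ltW//; have := W1 z; lra.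
(* The minorization is applied to the nonnegative functions [w + h] and [w - h]; together they bound
   the left side by [Q w z - al * nu w]. *)
have bQ z : W z <= R0 -> `|Q h z - al * nu h| <= 1 - al + be * (gam * W z + K).
  move=> Wz; have q := Qw z.
  have p1 : al * nu (fun z => w z + 1 * h z) <= Q (fun z => w z + 1 * h z) z.
    apply: Qmin => //; first exact: wboundedDZ.
    by move=> u; have := hle u; rewrite ler_norml mul1r /w => /andP[]; lra.
  have p2 : al * nu (fun z => w z + (-1) * h z) <=
            Q (fun z => w z + (-1) * h z) z.
    apply: Qmin => //; first exact: wboundedDZ.
    by move=> u; have := hle u; rewrite ler_norml mulN1r /w => /andP[]; lra.
  have alw : al <= al * nu w by rewrite ler_peMr// ltW.
  rewrite (markovDZ (QM.2 z) _ wW hW) (markovDZ nuM _ wW hW) in p1.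
  rewrite (markovDZ (QM.2 z) _ wW hW) (markovDZ nuM _ wW hW) in p2.
  by rewrite ler_norml; apply/andP; split; lra.
have -> : Q h x - Q h y = (Q h x - al * nu h) - (Q h y - al * nu h) by ring.
apply: (le_trans (ler_normB _ _)).
apply: (le_trans (lerD (bQ _ Wx) (bQ _ Wy))).
have S0 : 0 <= be * S by rewrite mulr_ge0 ?ltW// /S; lra.
have : eta * (be * S) <= (1 - gam) * (be * S) by rewrite ler_wpM2r.
by rewrite /S; lra.
Qed.

(** With [t = (1 - kap) / p] it turns a rate [kap] per [p] steps into the rate [1 - t] per step,
    without a root. *)
Lemma bernoulli_ineq (t : R) n : 0 <= t <= 1 -> 1 - n%:R * t <= (1 - t) ^+ n.
Proof.
move=> /andP[t0 t1]; elim: n => [|n IH]; first by rewrite expr0 mul0r subr0.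
apply: (@le_trans _ _ ((1 - t) * (1 - n%:R * t))).
  have : 0 <= n%:R * (t * t) by rewrite !mulr_ge0.
  by rewrite -natr1; lra.
by rewrite exprS ler_wpM2l// subr_ge0.
Qed.

Lemma harris_geometric (P : (T -> R) -> T -> R) (nu : (T -> R) -> R)
    (gam K : R) (p : nat) :
  markov_operator P -> markov_functional nu -> (0 < p)%N ->
  0 <= gam < 1 -> 0 <= K -> (forall x, P W x <= gam * W x + K) ->
  (forall R0, exists2 al, 0 < al & forall x g, W x <= R0 -> wbounded g ->
     (forall y, 0 <= g y) -> al * nu g <= iter p P g x) ->
  exists C rho, [/\ 0 <= C, 0 < rho < 1 &
    forall g, wbounded g -> (forall x, `|g x| <= W x) ->
    forall n x y,
      `|iter n P g x - iter n P g y| <= C * rho ^+ n * (W x + W y)].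
Proof.
move=> PM nuM p0 gam01 K0 PK Pmin.
have /andP[gam0 gam1] := gam01.
have D0 : 0 < 1 - gam by rewrite subr_gt0.
pose K' := K / (1 - gam).
have K'0 : 0 <= K' by rewrite divr_ge0// ltW.
have PnW n x : iter n P W x <= W x + K'.
  apply: (le_trans (markov_operator_iter_drift n PM gam01 PK K0 x)).
  rewrite lerD2r ler_piMl//; first exact: le_trans ler01 (W1 x).
  by rewrite exprn_ile1// ltW.
pose Q := iter p P.
have QM : markov_operator Q by exact: markov_operator_iter.
have QK x : Q W x <= gam * W x + K'.
  apply: (le_trans (markov_operator_iter_drift p PM gam01 PK K0 x)).
  rewrite lerD2r ler_wpM2r//; first exact: le_trans ler01 (W1 x).
  by case: p p0 {Pmin Q QM} => // q _; rewrite exprS ler_piMr// exprn_ile1// ltW.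
(* At this level [(1 - gam) * R0] exceeds [2 * K'] by exactly 1. *)
have [al0 al0_gt0 Qmin0] := Pmin ((2 * K' + 1) / (1 - gam)).
pose al := Num.min al0 1.
have al01 : 0 < al <= 1 by rewrite lt_min al0_gt0 ltr01 ge_min lexx orbT.
have [] := @harris_contraction Q nu gam K' al ((2 * K' + 1) / (1 - gam)) QM nuM
  gam01 K'0 al01 _ QK.
- by rewrite [ltRHS]mulrC divfK ?gt_eqF// ltrDl.
- move=> x g Wx gW g0; apply: le_trans (Qmin0 x g Wx gW g0).
  rewrite ler_wpM2r// ?ge_min ?lexx//.
  by case: nuM => _ + _; apply.
move=> be [kap [be0 /andP[kap0 kap1] contr]].
(* Chosen so that every [iter j P g] with [j] arbitrary starts within [M * (2 + be * (W x + W y))];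
   the incomplete block of steps is thus absorbed in the initial bound. *)
pose M := (1 + K') / be.
have M0 : 0 < M by rewrite divr_gt0//; lra.
have Q_iter k g : wbounded g -> (forall x, `|g x| <= W x) -> forall j x y,
    `|iter k Q (iter j P g) x - iter k Q (iter j P g) y| <=
      kap ^+ k * M * (2 + be * (W x + W y)).
  move=> gW gle j; elim: k => [|k IH] x y; last first.
    rewrite !iterS exprS -[_ * _ * M]mulrA; apply: contr => //.
      by rewrite mulr_gt0// exprn_gt0.
    by apply: (markov_operator_iter k QM).1; apply: (markov_operator_iter j PM).1.
  rewrite expr0 mul1r /=; apply: (le_trans (ler_normB _ _)).
  have jle z : `|iter j P g z| <= W z + K'.
    apply: le_trans (PnW j z).
    by apply: (markov_norm_le ((markov_operator_iter j PM).2 z)) => //;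
      exact: wbounded_weight.
  apply: (le_trans (lerD (jle x) (jle y))).
  have -> : M * (2 + be * (W x + W y)) = M * 2 + (1 + K') * (W x + W y).
    by rewrite /M; field; rewrite gt_eqF.
  have Wx1 := W1 x; have Wy1 := W1 y.
  have : K' * 2 <= K' * (W x + W y) by rewrite ler_wpM2l//; lra.
  by lra.
pose t := (1 - kap) / p%:R.
have p0R : 0 < p%:R :> R by rewrite ltr0n.
have t0 : 0 < t by rewrite divr_gt0// subr_gt0.
have t1 : t < 1.
  rewrite ltr_pdivrMr// mul1r; apply: (@lt_le_trans _ _ 1); first by lra.
  by rewrite ler1n.
pose rho := 1 - t.
have rho01 : 0 < rho < 1 by rewrite /rho; apply/andP; split; lra.
have /andP[rho0 rho1] := rho01.
have kap_rho : kap <= rho ^+ p.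
  apply: le_trans (bernoulli_ineq p _); last by rewrite (ltW t0) ltW.
  have -> : p%:R * t = 1 - kap by rewrite /t mulrC divfK ?gt_eqF.
  by lra.
(* The division by [kap] pays for rounding [n / p] down, and [2 + be * S <= (2 + be) * S] for
   [S = W x + W y] since [W >= 1]. *)
exists (M * (2 + be) / kap), rho; split => //.
  by apply: divr_ge0; [apply: mulr_ge0; [exact: ltW|lra]|exact: ltW].
move=> g gW gle n x y.
have iterE : iter n P g = iter (n %/ p) Q (iter (n %% p) P g).
  rewrite [in LHS](divn_eq n p) iterD; elim: (n %/ p)%N => [//|k IH].
  by rewrite mulSn iterD IH iterS.
rewrite iterE; apply: (le_trans (Q_iter _ _ gW gle _ x y)).
have kn : kap ^+ (n %/ p) * kap <= rho ^+ n.
  rewrite -exprSr; apply: (@le_trans _ _ ((rho ^+ p) ^+ (n %/ p).+1)).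
    by rewrite lerXn2r ?nnegrE// ?ltW// ?exprn_gt0.
  rewrite -exprM; apply: ler_wiXn2l; [exact: ltW|exact: ltW|].
  by rewrite mulnC ltnW// ltn_ceil.
have Wx1 := W1 x; have Wy1 := W1 y.
have -> : M * (2 + be) / kap * rho ^+ n * (W x + W y) =
    (rho ^+ n / kap) * M * ((2 + be) * (W x + W y)).
  by field; rewrite gt_eqF.
apply: ler_pM.
- by apply: mulr_ge0; [apply: exprn_ge0|]; exact: ltW.
- have : 0 <= be * (W x + W y) by apply: mulr_ge0; [exact: ltW|lra].
  by lra.
- by apply: ler_wpM2r; [exact: ltW|rewrite ler_pdivlMr].
- by rewrite [leRHS]mulrDl lerD2r; lra.
Qed.

End WeightedFunctions.

(** * Chains driven by i.i.d. noise *)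

Section WeightedIntegration.
Context {d} {T : measurableType d} {R : realType} (W : T -> R).
Hypotheses (mW : measurable_fun [set: T] W) (W1 : forall x, 1 <= W x).

Lemma wbounded_integrable (m : {measure set T -> \bar R}) g :
  m.-integrable [set: T] (EFin \o W) -> wbounded W g ->
  m.-integrable [set: T] (EFin \o g).
Proof.
move=> iW [mg [C gC]].
apply: (@le_integrable _ _ _ m setT measurableT _ (fun x => C%:E * (W x)%:E)%E).
- exact/measurable_EFinP.
- move=> x _ /=; rewrite lee_fin; apply: (le_trans (gC x)).
  exact: ler_norm.
- exact: integrableZl.
Qed.

Lemma integral_markov_functional (m : probability T R) :
  m.-integrable [set: T] (EFin \o W) ->
  markov_functional W (fun g => \int[m]_x g x).
Proof.
move=> iW; split => [g h c gW hW|g gW g0|].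
- have ig := wbounded_integrable iW gW.
  have ih := wbounded_integrable iW hW.
  rewrite RintegralD ?RintegralZl//.
  exact: (wbounded_integrable iW (wboundedZ W1 c hW)).
- exact: Rintegral_ge0.
- by rewrite Rintegral_cst// [X in fine X]probability_setT mulr1.
Qed.

Lemma EFin_Rintegral (m : {measure set T -> \bar R}) g :
  m.-integrable [set: T] (EFin \o g) ->
  (\int[m]_x g x)%:E = (\int[m]_x (g x)%:E)%E.
Proof. by move=> ig; rewrite fineK//; exact: integrable_fin_num. Qed.

End WeightedIntegration.

Section RandomIteration.
Context {d d'} {T : measurableType d} {E : measurableType d'} {R : realType}.
Context (mu : probability E R) (F : {mfun (T * E)%type >-> T}).
Context (W : T -> R) (L : R).
Hypotheses (mW : measurable_fun [set: T] W) (W1 : forall x, 1 <= W x)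
  (WL : forall x, (\int[mu]_u (W (F (x, u)))%:E <= (L * W x)%:E)%E).

Definition transition (g : T -> R) (x : T) : R := \int[mu]_u g (F (x, u)).

Lemma measurable_step x : measurable_fun [set: E] (fun u => F (x, u)).
Proof. exact: measurableT_comp (measurable_funP F) (pair1_measurable x). Qed.

Lemma step_integrable g x : wbounded W g ->
  mu.-integrable [set: E] (fun u => (g (F (x, u)))%:E).
Proof.
move=> gW; pose W' u := W (F (x, u)).
have W0 u : 0 <= W' u by exact: le_trans ler01 (W1 _).
have mW' : measurable_fun [set: E] W' by exact: measurableT_comp (measurable_step x).
apply: (@wbounded_integrable _ _ _ W' mu (fun u => g (F (x, u)))); last first.
  case: gW => mg [C gC]; split; last by exists C => u.
  exact: measurableT_comp (measurable_step x).
apply/integrableP; split; first exact/measurable_EFinP.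
under eq_integral do rewrite /= ger0_norm//.
by apply: le_lt_trans (WL x) _; rewrite ltry.
Qed.

Lemma transitionE g x : wbounded W g ->
  (transition g x)%:E = (\int[mu]_u (g (F (x, u)))%:E)%E.
Proof. by move=> gW; rewrite EFin_Rintegral//; exact: step_integrable. Qed.

Lemma measurable_transition g : wbounded W g ->
  measurable_fun [set: T] (transition g).
Proof.
move=> gW; have [mg [C gC]] := gW.
have nonneg h : wbounded W h -> (forall x, 0 <= h x) ->
    measurable_fun [set: T] (transition h).
  move=> hW h0; apply/measurable_EFinP.
  rewrite (_ : _ \o _ = fubini_F mu (EFin \o h \o F)); last first.
    by apply/funext => x /=; rewrite transitionE.
  apply: measurable_fun_fubini_tonelli_F.
    apply: measurableT_comp (measurable_funP F).
    by apply/measurable_EFinP; case: hW.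
  by move=> z; rewrite /= lee_fin.
have WW := wbounded_weight mW W1.
have gCW : wbounded W (fun x => g x + C * W x) by exact: wboundedDZ.
have CWW : wbounded W (fun x => C * W x) by exact: wboundedZ.
have CW0 x : 0 <= C * W x by exact: le_trans (gC x).
(* Tonelli gives measurability for nonnegative integrands only, so [g] is written as the difference
   of [g + C * W] and [C * W]. *)
have -> : transition g =
    (fun x => transition (fun y => g y + C * W y) x
              - transition (fun y => C * W y) x).
  apply/funext => x; rewrite /transition -RintegralB//.
  - by apply: eq_Rintegral => u _; rewrite addrK.
  - exact: (step_integrable x gCW).
  - exact: (step_integrable x CWW).
apply: measurable_funB; apply: nonneg => // x.
by rewrite -lerBlDr sub0r; have := gC x; rewrite ler_norml => /andP[].
Qed.

Lemma transition_markov : markov_operator W transition.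
Proof.
split => [g gW|x].
  split; first exact: measurable_transition.
  have [mg [C gC]] := gW; exists (`|C| * L) => x.
  rewrite -lee_fin -abse_EFin transitionE//.
  apply: (le_trans (le_abse_integral _ _ _)) => //.
    by case/integrableP : (step_integrable x gW).
  apply: (@le_trans _ _ (\int[mu]_u (`|C|%:E * (W (F (x, u)))%:E))%E).
    apply: ge0_le_integral => //.
    - by apply: measurableT_comp => //; case/integrableP : (step_integrable x gW).
    - apply: measurable_funeM; apply/measurable_EFinP.
      exact: measurableT_comp (measurable_step x).
    - move=> u _; rewrite /= lee_fin; apply: (le_trans (gC _)).
      by rewrite ler_wpM2r ?ler_norm//; exact: le_trans ler01 (W1 _).
  rewrite ge0_integralZl//.
  - by rewrite -mulrA EFinM lee_wpmul2l.
  - apply/measurable_EFinP; exact: measurableT_comp (measurable_step x).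
  - by move=> u _; rewrite lee_fin; exact: le_trans ler01 (W1 _).
split => [g h c gW hW|g gW g0|].
- rewrite /transition RintegralD//.
  + by congr (_ + _); rewrite RintegralZl//; exact: (step_integrable x hW).
  + exact: (step_integrable x gW).
  + exact: (step_integrable x (wboundedZ W1 c hW)).
- exact: Rintegral_ge0.
- by rewrite /transition Rintegral_cst// [X in fine X]probability_setT mulr1.
Qed.

Definition push (m : probability T R) : probability T R :=
  distribution (m \x mu)%E F.

Lemma step_integrable_product (m : probability T R) g :
  m.-integrable [set: T] (EFin \o W) -> wbounded W g ->
  (m \x mu)%E.-integrable [set: T * E] (EFin \o g \o F).
Proof.
move=> iW gW; have [mg [C gC]] := gW.
apply/integrable12ltyP.
  by apply: measurableT_comp (measurable_funP F); exact/measurable_EFinP.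
have gnW : wbounded W (fun x => `|g x|).
  by split; [exact: measurableT_comp|exists C => x; rewrite normr_id].
rewrite (eq_integral (fun x => (transition (fun y => `|g y|) x)%:E)); last first.
  by move=> x _; rewrite transitionE.
have iP := wbounded_integrable iW (transition_markov.1 _ gnW).
rewrite -EFin_Rintegral; first by rewrite ltry.
exact: iP.
Qed.

Lemma integral_push (m : probability T R) g :
  m.-integrable [set: T] (EFin \o W) -> wbounded W g ->
  (\int[push m]_x (g x)%:E = \int[m]_x (transition g x)%:E)%E.
Proof.
move=> iW gW; have [mg _] := gW.
have ip := step_integrable_product iW gW.
rewrite /push integral_distribution//; last exact/measurable_EFinP.
rewrite -integral12_prod_meas1//.
by apply: eq_integral => x _; rewrite transitionE.
Qed.

Lemma push_integrable (m : probability T R) :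
  m.-integrable [set: T] (EFin \o W) ->
  (push m).-integrable [set: T] (EFin \o W).
Proof.
move=> iW; apply: integrable_pushforward => //; first exact/measurable_EFinP.
exact: (step_integrable_product iW (wbounded_weight mW W1)).
Qed.

Definition law (x : T) (n : nat) : probability T R := iter n push (dirac x).

Lemma law_integral x n :
  (law x n).-integrable [set: T] (EFin \o W) /\
  forall g, wbounded W g ->
    (\int[law x n]_y (g y)%:E = (iter n transition g x)%:E)%E.
Proof.
elim: n => [|n [iW IH]].
  split => [|g [mg _]]; last by rewrite integral_dirac ?diracT ?mul1e//; exact/measurable_EFinP.
  apply/integrableP; split; first exact/measurable_EFinP.
  rewrite integral_dirac ?diracT ?mul1e ?ltry//.
  by apply: measurableT_comp => //; exact/measurable_EFinP.
split => [|g gW]; first exact: push_integrable.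
by rewrite /law iterS integral_push// IH ?iterSr//; exact: transition_markov.1.
Qed.

End RandomIteration.

(** * Limits in total variation *)

Section TotalVariationLimit.
Context {d} {T : measurableType d} {R : realType}.

Lemma fin_num_prob (P : probability T R) A : measurable A -> P A \is a fin_num.
Proof. by move=> mA; rewrite fin_num_measure. Qed.

(** The limit is taken set by set. Finite additivity passes to it termwise; countable additivity
    does because [del] is uniform over sets, so that one fixed [m k] approximates the limit on a
    union and on all its partial unions at once. *)
Lemma tv_cauchy_limit (m : nat -> probability T R) (del : R^nat) :
  del @ \oo --> (0 : R) ->
  (forall n k A, measurable A -> (n <= k)%N ->
     `|fine (m n A) - fine (m k A)| <= del n) ->
  exists G : probability T R, forall n A, measurable A ->
    `|fine (m n A) - fine (G A)| <= del n.
Proof.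
move=> del0 mC.
pose u A : R^nat := fun n => fine (m n A).
have u_cvg A : measurable A -> cvgn (u A).
  move=> mA; apply/cauchy_cvgP/cauchy_exP => e e0.
  have /cvgrPdist_lt /(_ e e0) [N _ Nd] := del0.
  exists (u A N), N => // k /= Nk; rewrite /ball /=.
  apply: le_lt_trans (mC _ _ _ mA Nk) _.
  by apply: le_lt_trans (Nd N _) => //=; rewrite sub0r normrN ler_norm.
(* The absolute value makes [g] nonnegative on nonmeasurable sets too. *)
pose g A : R := `|limn (u A)|.
have ug A : measurable A -> u A @ \oo --> g A.
  move=> mA; rewrite /g ger0_norm; first exact: u_cvg.
  by apply: limr_ge; [exact: u_cvg|apply: nearW => n; exact: fine_ge0].
have uge n A : measurable A -> `|u A n - g A| <= del n.
  move=> mA; have c : (fun k => `|u A n - u A k|) @ \oo --> `|u A n - g A|.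
    by apply: cvg_norm; apply: cvgB; [exact: cvg_cst|exact: ug].
  apply: (cvgr_to_le c); exists n => // k /= nk; exact: mC.
have uU n F k : (forall i : nat, measurable (F i)) -> trivIset setT F ->
    \sum_(0 <= i < n) u (F i) k = u (\big[setU/set0]_(i < n) F i) k.
  move=> mF tF.
  have -> : u (\big[setU/set0]_(i < n) F i) k = fine (\sum_(i < n) m k (F i))%E.
    congr fine; apply: measure_semi_additive_ord_I => //.
      exact: sub_trivIset tF.
    exact: bigsetU_measurable.
  rewrite big_mkord (eq_bigr (fun i : 'I_n => (fine (m k (F i)))%:E)) ?sumEFin//.
  by move=> i _; rewrite fineK// fin_num_prob.
pose G A : \bar R := (g A)%:E.
have G0 : G set0 = 0%E.
  congr EFin; apply/esym/(cvg_unique _ _ (ug _ measurable0)) => //.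
  by rewrite (_ : u set0 = cst 0); [exact: cvg_cst|apply/funext => n; rewrite /u measure0].
have Gge0 A : (0 <= G A)%E by rewrite lee_fin normr_ge0.
have Gadd : semi_sigma_additive G.
  move=> F mF tF mUF; set U := \bigcup_n F n.
  pose Un n := \big[setU/set0]_(i < n) F i.
  have mUn n : measurable (Un n) by exact: bigsetU_measurable.
  have gU n : \sum_(0 <= i < n) g (F i) = g (Un n).
    have c : (fun k => \sum_(0 <= i < n) u (F i) k) @ \oo -->
        \sum_(0 <= i < n) g (F i).
      elim: n => [|n IH].
        by under eq_fun do rewrite big_nil; rewrite big_nil; exact: cvg_cst.
      under eq_fun do rewrite big_nat_recr//=.
      by rewrite big_nat_recr//=; apply: cvgD => //; exact: ug.
    apply: (cvg_unique _ c) => //.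
    rewrite (_ : (fun k => _) = u (Un n)); first exact: ug.
    by apply/funext => k; exact: uU.
  rewrite /G; under eq_fun do rewrite sumEFin gU.
  apply: cvg_EFin; first exact: nearW.
  apply/cvgrPdist_le => e e0.
  have e3 : 0 < e / 3 by rewrite divr_gt0.
  have /cvgrPdist_lt /(_ _ e3) [k _ kd] := del0.
  have dk : del k <= e / 3.
    by apply: le_trans (ltW (kd k _)) => //=; rewrite sub0r normrN ler_norm.
  have : (fun n => u (Un n) k) @ \oo --> u U k.
    have /fine_cvgP[_] :
        (fun n => \sum_(0 <= i < n) m k (F i))%E @ \oo --> (u U k)%:E.
      rewrite (_ : (u U k)%:E = m k U); last exact/fineK/fin_num_prob.
      exact: measure_semi_sigma_additive.
    apply: cvg_trans; apply: near_eq_cvg; apply: nearW => n /=.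
    rewrite -uU// /u big_mkord (eq_bigr (fun i : 'I_n => (fine (m k (F i)))%:E)).
      by rewrite sumEFin/= big_mkord.
    by move=> i _; rewrite fineK// fin_num_prob.
  move/cvgrPdist_le => /(_ _ e3) [N _ Nd]; exists N => // n /= Nn.
  have h1 := uge k _ mUF; have h2 := uge k _ (mUn n); have h3 := Nd n Nn.
  rewrite -[e](_ : e / 3 + e / 3 + e / 3 = e); last by field.
  have -> : g U - g (Un n) = - (u U k - g U) + (u U k - u (Un n) k) + (u (Un n) k - g (Un n)).
    by ring.
  apply: (le_trans (ler_normD _ _)); apply: lerD; last exact: le_trans h2 dk.
  apply: (le_trans (ler_normD _ _)); apply: lerD => //.
  by rewrite normrN; exact: le_trans h1 dk.
pose GM := isMeasure.Build _ _ _ G G0 Gge0 Gadd.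
pose Gm : {measure set T -> \bar R} := HB.pack G GM.
have G1 : Gm setT = 1%E.
  congr EFin; apply/esym/(cvg_unique _ _ (ug _ measurableT)) => //.
  rewrite (_ : u setT = cst 1); first exact: cvg_cst.
  by apply/funext => n; rewrite /u [X in fine X]probability_setT.
pose GP := Measure_isProbability.Build _ _ _ Gm G1.
pose Gp : probability T R := HB.pack G GM GP.
by exists Gp => n A mA; exact: uge.
Qed.

(* The staircase [N^-1 * #{k < N | (k + 1) / N <= h}] lies within [N^-1] of h. *)
Lemma staircase_bounds (t : R) n : 0 <= t ->
  \sum_(k < n) (k.+1%:R <= t)%R%:R <= t /\
  (t <= n%:R -> t <= \sum_(k < n) (k.+1%:R <= t)%R%:R + 1).
Proof.
move=> t0; have full j : j%:R <= t -> \sum_(k < j) (k.+1%:R <= t)%R%:R = j%:R :> R.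
  move=> jt; rewrite (eq_bigr (fun=> 1)) ?sumr_const ?card_ord// => k _.
  by rewrite (le_trans _ jt)// ler_nat.
elim: n => [|n [IH1 IH2]]; first by rewrite big_ord0; split => //; lra.
have [nt|tn] := leP n.+1%:R t.
  by rewrite full//; split => //; lra.
rewrite big_ord_recr/= (lt_geF tn) addr0; split => // _.
have [tn'|nt] := leP t n%:R; first exact: IH2.
by rewrite full ?(ltW nt)// natr1 ltW.
Qed.

Lemma unit_valued_integrable (m : probability T R) (h : T -> R) :
  measurable_fun [set: T] h -> (forall x, 0 <= h x <= 1) ->
  m.-integrable [set: T] (EFin \o h).
Proof.
move=> mh h01.
apply: (@wbounded_integrable _ _ _ (fun=> 1)).
  exact: finite_measure_integrable_cst.
by split => //; exists 1 => x; have /andP[] := h01 x; rewrite mul1r => /ger0_norm ->.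
Qed.

(** Up to [N^-1], [h] is the average of the indicators of [N] of its superlevel sets, and an average
    of errors [del] is again at most [del]. *)
Lemma tv_integral_le (m1 m2 : probability T R) (del : R) (h : T -> R) :
  (forall A, measurable A -> `|fine (m1 A) - fine (m2 A)| <= del) ->
  measurable_fun [set: T] h -> (forall x, 0 <= h x <= 1) ->
  `|\int[m1]_x h x - \int[m2]_x h x| <= del.
Proof.
move=> m12 mh h01; apply/ler_addgt0Pr => e e0.
(* The staircase error [N^-1] is incurred once for each measure, hence [2 / N <= e]. *)
pose N := (Num.truncn (2 / e)).+1.
have N0 : (0 : R) < N%:R by rewrite ltr0n.
have Ne : 2 / N%:R <= e.
  rewrite ler_pdivrMr// mulrC -ler_pdivrMr//.
  by rewrite ltW// -natr1 /N; exact: truncnS_gt.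
pose S k := [set x | k.+1%:R <= N%:R * h x].
have mS k : measurable (S k).
  rewrite -[S k]setTI; apply: measurable_fun_le => //=.
  by apply: measurable_funM.
pose s x : R := N%:R^-1 * \sum_(k < N) \1_(S k) x.
have sE x : s x = N%:R^-1 * \sum_(k < N) (k.+1%:R <= N%:R * h x)%R%:R.
  by congr (_ * _); apply: eq_bigr => k _; rewrite indicE mem_setE.
have sh x : s x <= h x <= s x + N%:R^-1.
  have /andP[h0 h1] := h01 x.
  have [] := @staircase_bounds (N%:R * h x) N; first by rewrite mulr_ge0// ltW.
  rewrite ler_piMr ?(ltW N0)// sE => /[swap]/(_ isT).
  set q := \sum_(k < N) _ => b1 b2.
  by rewrite ler_pdivrMl// b2/= -[X in _ + X]mulr1 -mulrDr ler_pdivlMl.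
have intS (m : probability T R) : m.-integrable [set: T] (EFin \o s).
  apply: (@wbounded_integrable _ _ _ (fun=> 1)).
    exact: finite_measure_integrable_cst.
  split.
    apply: measurable_funM => //; apply: measurable_sum => k; exact: measurable_indic.
  exists 1 => x; have /andP[h0 h1] := h01 x; have /andP[s1 _] := sh x.
  rewrite ger0_norm ?mul1r ?(le_trans s1)//.
  by rewrite mulr_ge0 ?invr_ge0 ?sumr_ge0// => k _; rewrite indicE.
have ints (m : probability T R) : \int[m]_x s x = N%:R^-1 * \sum_(k < N) fine (m (S k)).
  have E1 : (\int[m]_x (\sum_(k < N) (\1_(S k) x : R)%:E) =
      (\sum_(k < N) fine (m (S k)))%:E)%E.
    rewrite ge0_integral_sum//; last first.
      by move=> k; exact/measurable_EFinP/measurable_indic.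
    rewrite -sumEFin; apply: eq_bigr => k _.
    by rewrite integral_indic// setIT fineK//; exact: fin_num_prob.
  rewrite /Rintegral /s; under eq_integral do rewrite EFinM -sumEFin.
  rewrite ge0_integralZl_EFin//.
  - by rewrite E1.
  - by move=> x _; apply: sume_ge0 => k _; rewrite lee_fin indicE.
  - by apply: emeasurable_sum => k; exact/measurable_EFinP/measurable_indic.
have ssE : `|\int[m1]_x s x - \int[m2]_x s x| <= del.
  rewrite !ints -mulrBr -sumrB normrM gtr0_norm ?invr_gt0// ler_pdivrMl//.
  apply: (le_trans (ler_norm_sum _ _ _)).
  rewrite -[N in leRHS]card_ord mulr_natl -sumr_const.
  by apply: ler_sum => k _; exact: m12.
have ish (m : probability T R) : m.-integrable [set: T] (EFin \o h) :=
  unit_valued_integrable m mh h01.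
have inth (m : probability T R) : \int[m]_x s x <= \int[m]_x h x <=
    \int[m]_x s x + N%:R^-1.
  apply/andP; split.
    apply: le_Rintegral; [by []|exact: intS|exact: ish|].
    by move=> x _; have /andP[] := sh x.
  have c : N%:R^-1 = \int[m]_x (cst (N%:R^-1 : R) x).
    by rewrite Rintegral_cst// [X in fine X]probability_setT mulr1.
  have ic : m.-integrable [set: T] (EFin \o cst (N%:R^-1 : R)).
    exact: finite_measure_integrable_cst.
  rewrite [X in _ + X]c -RintegralD//; last exact: intS.
  apply: le_Rintegral; [by []|exact: ish| |].
    by apply: (integrableD measurableT (intS m) ic).
  by move=> x _; have /andP[] := sh x.
have N1 : N%:R^-1 + N%:R^-1 <= e by move: Ne; lra.
have /andP[] := inth m1; have /andP[] := inth m2.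
move: ssE; rewrite !ler_norml => /andP[? ?] ? ? ? ?.
by apply/andP; split; lra.
Qed.

End TotalVariationLimit.

(** * Existence of the stationary law and weighted geometric convergence to it *)

Section ErgodicLimit.
Context {d d'} {T : measurableType d} {E : measurableType d'} {R : realType}.
Context (mu : probability E R) (F : {mfun (T * E)%type >-> T}).
Context (W : T -> R) (L : R).
Hypotheses (mW : measurable_fun [set: T] W) (W1 : forall x, 1 <= W x)
  (WL : forall x, (\int[mu]_u (W (F (x, u)))%:E <= (L * W x)%:E)%E).

Let P := transition mu F.
Let PM : markov_operator W P := transition_markov mW W1 WL.

Lemma wbounded_unit_valued (h : T -> R) :
  measurable_fun [set: T] h -> (forall x, 0 <= h x <= 1) ->
  wbounded W h /\ forall x, `|h x| <= W x.
Proof.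
move=> mh h01; have hW x : `|h x| <= W x.
  have /andP[h0 h1] := h01 x.
  by rewrite ger0_norm//; exact: le_trans (W1 x).
by split => //; split => //; exists 1 => x; rewrite mul1r.
Qed.

Lemma random_iteration_ergodic (C rho D : R) :
  0 <= C -> 0 < rho < 1 ->
  (forall g, wbounded W g -> (forall x, `|g x| <= W x) -> forall n x y,
     `|iter n P g x - iter n P g y| <= C * rho ^+ n * (W x + W y)) ->
  (forall n x, iter n P W x <= W x + D) ->
  exists G : probability T R,
    [/\ forall A, measurable A -> (\int[G]_x (P (\1_A) x)%:E = G A)%E,
        G.-integrable [set: T] (EFin \o W)
      & exists M, forall g, wbounded W g -> (forall x, `|g x| <= W x) ->
        forall n x, `|iter n P g x - \int[G]_y g y| <= M * rho ^+ n * W x].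
Proof.
move=> C0 /andP[rho0 rho1] geo PnW.
pose x0 : T := point.
pose lw := law mu F x0.
have lwE n g : wbounded W g -> \int[lw n]_y g y = iter n P g x0.
  by move=> gW; rewrite /Rintegral (law_integral mW W1 WL x0 n).2.
have indic01 A (x : T) : 0 <= (\1_A x : R) <= 1.
  by rewrite indicE; case: (_ \in _); rewrite lexx ler01.
have indicW A : measurable A -> wbounded W (\1_A) /\ forall x, `|\1_A x| <= W x.
  by move=> mA; apply: wbounded_unit_valued => //; exact: measurable_indic.
have lwA n A : measurable A -> fine (lw n A) = iter n P (\1_A) x0.
  move=> mA; rewrite -lwE; last exact: (indicW A mA).1.
  by rewrite /Rintegral integral_indic// setIT.
(* The law at time [k >= n] is the law at time [n] started from the law at time [k - n], under which
   [W] has mean at most [W x0 + D]. *)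
pose del n := C * (W x0 + (W x0 + D)) * rho ^+ n.
have del0 : del @ \oo --> (0 : R).
  by apply: cvg_geometric; rewrite gtr0_norm.
have [G lwG] : exists G : probability T R, forall n A, measurable A ->
    `|fine (lw n A) - fine (G A)| <= del n.
  apply: tv_cauchy_limit => // n k A mA nk; rewrite !lwA//.
  have [AW Ale] := indicW A mA.
  rewrite -(subnK nk) iterD /del -mulrA [_ * rho ^+ n]mulrC mulrA.
  apply: (@le_trans _ _ (C * rho ^+ n * (W x0 + iter (k - n) P W x0))).
    apply: (markov_dist_le mW W1 ((markov_operator_iter W1 (k - n) PM).2 x0)).
      exact: (markov_operator_iter W1 n PM).1.
    by move=> y; exact: geo.
  apply: ler_wpM2l; last by rewrite lerD2l.
  by rewrite mulr_ge0// exprn_ge0// ltW.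
have lwGh n (h : T -> R) : measurable_fun [set: T] h -> (forall x, 0 <= h x <= 1) ->
    `|iter n P h x0 - \int[G]_x h x| <= del n.
  move=> mh h01; rewrite -lwE; last exact: (wbounded_unit_valued mh h01).1.
  by apply: tv_integral_le => // A mA; exact: lwG.
have W0 x : 0 <= W x by exact: le_trans ler01 (W1 x).
(* The truncated weight is divided by [N.+1] to take values in the unit interval; [n] is then so
   large that scaling back costs at most [e]. *)
have minW (N : nat) : \int[G]_x Num.min (W x) N.+1%:R <= W x0 + D.
  apply/ler_addgt0Pr => e e0; have N0 : 0 < N.+1%:R :> R by [].
  have /cvgrPdist_lt /(_ (e / N.+1%:R)) := del0.
  move=> /(_ (divr_gt0 e0 N0)) [n _ /(_ n (leqnn n))].
  rewrite /= sub0r normrN => /(le_lt_trans (ler_norm _)) dn.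
  pose h x := N.+1%:R^-1 * Num.min (W x) N.+1%:R.
  have mmin : measurable_fun [set: T] (fun x => Num.min (W x) N.+1%:R).
    by apply: measurable_minr.
  have mh : measurable_fun [set: T] h by exact: measurable_funM.
  have h01 x : 0 <= h x <= 1.
    rewrite /h mulr_ge0 ?invr_ge0 ?le_min ?W0//=.
    by rewrite ler_pdivrMl// mulr1 ge_min lexx orbT.
  have ih := unit_valued_integrable G mh h01.
  have hE : \int[G]_x Num.min (W x) N.+1%:R = N.+1%:R * \int[G]_x h x.
    rewrite -RintegralZl//; apply: eq_Rintegral => x _.
    by rewrite /h mulrA divff ?mul1r// gt_eqF.
  have hW : N.+1%:R * iter n P h x0 <= W x0 + D.
    apply: le_trans (PnW n x0).
    rewrite -(markovZ W1 ((markov_operator_iter W1 n PM).2 x0)); last first.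
      exact: (wbounded_unit_valued mh h01).1.
    apply: (markov_le ((markov_operator_iter W1 n PM).2 x0)).
    - apply: wboundedZ => //; exact: (wbounded_unit_valued mh h01).1.
    - exact: wbounded_weight.
    - by move=> x; rewrite /h mulrA divff ?mul1r ?gt_eqF// ge_min lexx.
  rewrite hE.
  have := lwGh n h mh h01; rewrite distrC => /(le_trans (ler_norm _)) h1.
  have : N.+1%:R * (\int[G]_x h x - iter n P h x0) <= e.
    by rewrite mulrC -ler_pdivlMr// (le_trans h1)// ltW.
  by rewrite mulrBr; lra.
have intW : (\int[G]_x (W x)%:E <= (W x0 + D)%:E)%E.
  pose w (N : nat) x := (Num.min (W x) N.+1%:R)%:E.
  have wc x : w ^~ x @ \oo --> (W x)%:E.
    apply: cvg_EFin; first exact: nearW.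
    apply: cvg_near_cst; exists (Num.truncn (W x)).+1 => // n /= Wn.
    rewrite /w /= min_l//; apply: (le_trans (ltW (truncnS_gt _))).
    by rewrite ler_nat; apply: leqW.
  have wI N : (\int[G]_x w N x = (\int[G]_x Num.min (W x) N.+1%:R)%:E)%E.
    rewrite /Rintegral fineK//.
    have m1 : measurable_fun [set: T] (fun x => Num.min (W x) (N.+1%:R : R)).
      by apply: measurable_minr.
    apply: integrable_fin_num => //.
    apply: (@wbounded_integrable _ _ _ (fun=> 1)).
      exact: finite_measure_integrable_cst.
    split => //; exists N.+1%:R => x; rewrite mulr1 ger0_norm.
      by rewrite ge_min lexx orbT.
    by rewrite le_min W0 ler0n.
  have : (fun N => \int[G]_x w N x)%E @ \oo --> (\int[G]_x (W x)%:E)%E.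
    under [X in _ --> X]eq_integral do rewrite -(cvg_lim _ (wc _))//.
    apply: cvg_monotone_convergence => //.
    - by move=> n; apply/measurable_EFinP; apply: measurable_minr.
    - by move=> n x _; rewrite lee_fin le_min W0/=.
    - move=> x _ n k nk; rewrite lee_fin le_min ge_min lexx/=.
      by rewrite ge_min ler_nat ltnS nk orbT.
  move=> c; apply: (cvge_to_le c); apply: nearW => N.
  by rewrite wI lee_fin.
have iW : G.-integrable [set: T] (EFin \o W).
  apply/integrableP; split; first exact/measurable_EFinP.
  under eq_integral do rewrite /= ger0_norm//.
  by apply: le_lt_trans intW _; rewrite ltry.
have GM := integral_markov_functional W1 iW.
have stat A : measurable A -> \int[G]_x P (\1_A) x = fine (G A).
  move=> mA; have [AW Ale] := indicW A mA.
  have PA01 x : 0 <= P (\1_A) x <= 1.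
    apply/andP; split.
      by case: (PM.2 x) => _ + _; apply.
    rewrite -[leRHS](markov_cst W1 (PM.2 x)); apply: (markov_le (PM.2 x)) => //.
    exact: wbounded_cst.
  (* Both terms are close to [iter n.+1 P (\1_A) x0]: the first by the estimate at time [n] for the
     unit-valued function [P (\1_A)], the second by the one at time [n.+1] for [A]. *)
  have cmp n : `|\int[G]_x P (\1_A) x - fine (G A)| <= del n + del n.+1.
    have h1 := lwGh n _ (PM.1 _ AW).1 PA01.
    have h2 := lwG n.+1 A mA.
    rewrite lwA// iterSr in h2.
    by move: h1 h2; rewrite !ler_norml => /andP[? ?] /andP[? ?]; apply/andP; split; lra.
  have : (fun n => del n + del n.+1) @ \oo --> (0 + 0 : R).
    by apply: cvgD => //; rewrite (cvg_shiftS del).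
  rewrite addr0 => c0; apply/eqP; rewrite -subr_eq0 -normr_le0.
  by apply: (cvgr_to_ge c0); exact: nearW.
have statE A : measurable A -> (\int[G]_x (P (\1_A) x)%:E = G A)%E.
  move=> mA; rewrite -EFin_Rintegral; last first.
    exact: (wbounded_integrable iW (PM.1 _ (indicW A mA).1)).
  by rewrite stat// fineK//; exact: fin_num_prob.
have inv g : wbounded W g -> \int[G]_x P g x = \int[G]_x g x.
  move=> gW; rewrite /Rintegral; congr fine.
  rewrite -(integral_push mW W1 WL iW gW).
  apply: eq_measure_integral => A mA _.
  apply: etrans (statE A mA); rewrite -(integral_push mW W1 WL iW (indicW A mA).1).
  by rewrite integral_indic// setIT.
exists G; split => //.
(* By invariance the limit is the mean of [iter n P g] under [G], so the two-point bound is averaged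
   over its second point. *)
exists (C * (1 + \int[G]_x W x)) => g gW gle n x.
have -> : \int[G]_y g y = \int[G]_y iter n P g y.
  elim: n => [//|n IH]; rewrite iterS inv//.
  exact: (markov_operator_iter W1 n PM).1.
have PnW' := (markov_operator_iter W1 n PM).1 g gW.
apply: (le_trans (markov_dist_le mW W1 GM PnW' (fun y => geo g gW gle n x y))).
rewrite [leRHS](_ : _ = C * rho ^+ n * (W x + \int[G]_y W y * W x)); last by ring.
apply: ler_wpM2l; first by rewrite mulr_ge0// exprn_ge0// ltW.
by rewrite lerD2l ler_peMr//; exact: Rintegral_ge0.
Qed.

End ErgodicLimit.

(** * Minorization for an affine function of the noise *)

Lemma pushforward_measure d1 d2 (T1 : measurableType d1) (T2 : measurableType d2)
    (R : realType) (m : {measure set T1 -> \bar R}) (f : T1 -> T2) :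
  measurable_fun [set: T1] f ->
  exists pm : {measure set T2 -> \bar R}, forall A, pm A = m (f @^-1` A).
Proof.
move=> mf; unshelve (refine (ex_intro _
  (pushforward m f : {measure set T2 -> \bar R}) _)); first exact: mf.
by [].
Qed.

Section AffineNoise.
Context {R : realType}.

(** The right side is a scaled pushforward measure that gives half-open intervals their length, and
    such a measure is unique. *)
Lemma lebesgue_measure_affine (a b : R) (b0 : 0 < b) (A : set R) :
  measurable A ->
  (lebesgue_measure A =
   b%:E * lebesgue_measure ((fun u => a + b * u)%R @^-1` A))%E.
Proof.
move=> mA; pose aff (u : R) : measurableTypeR R := a + b * u.
have maff : measurable_fun [set: measurableTypeR R] (aff : measurableTypeR R -> _).
  by apply: measurable_funD => //; apply: measurable_funM.
have [pm pmE] := pushforward_measure lebesgue_measure maff.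
transitivity (mscale (NngNum (ltW b0)) pm A); last by rewrite /mscale pmE.
apply: lebesgue_measure_unique => // _ [[x y] _ <-] /=.
rewrite /mscale pmE /=.
have -> : aff @^-1` `]x, y]%classic = `](x - a) / b, (y - a) / b]%classic.
  apply/seteqP; split => u /=; rewrite !in_itv/= /aff ltr_pdivrMr// ler_pdivlMr//.
    by rewrite ltrBlDl lerBrDl [u * b]mulrC.
  by rewrite ltrBlDl lerBrDl [u * b]mulrC.
rewrite !lebesgue_measure_itv/= !lte_fin ltr_pM2r ?invr_gt0// ltrD2r.
case: ifPn => xy; last by rewrite mule0.
rewrite -!EFinD -EFinM; congr EFin.
by rewrite -mulrBl mulrCA divff ?gt_eqF// mulr1; ring.
Qed.

Let unif : probability (measurableTypeR R) R := uniform_prob (@ltr01 R).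

Lemma measurable_idR : measurable_fun [set: measurableTypeR R] (idfun : measurableTypeR R -> R).
Proof. by move=> _ A mA; rewrite setTI; exact: mA. Qed.

Let idR : {mfun measurableTypeR R >-> R} :=
  HB.pack (idfun : measurableTypeR R -> R)
    (isMeasurableFun.Build _ _ _ _ _ measurable_idR).

(* The library's uniform law lives on [measurableTypeR R], whose display differs
   from that of [R]. *)
Definition uniform_unit : probability R R := distribution unif idR.

Lemma uniform_unit_integralE (h : R -> \bar R) : measurable_fun [set: R] h ->
  (forall v, 0 <= h v)%E ->
  (\int[uniform_unit]_v h v =
   \int[lebesgue_measure]_(v in `[0%R, 1%R]) h v)%E.
Proof.
move=> mh h0; rewrite /uniform_unit ge0_integral_distribution//.
by rewrite integral_uniform// subr0 invr1 mul1e.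
Qed.

Lemma uniform_unitE (A : set R) : measurable A ->
  uniform_unit A = lebesgue_measure (A `&` `[0, 1]%classic).
Proof.
move=> mA; have := @uniform_unit_integralE (EFin \o \1_A).
rewrite /= !integral_indic// setIT; apply => [|x]; last by rewrite lee_fin indicE.
exact/measurable_EFinP/measurable_indic.
Qed.

(** If [a + b * u] lies in the unit interval then [u] is at most [(1 + al) / b1] in absolute value,
    where [f] has a positive lower bound; the change of variables divides that bound by [b]. *)
Lemma density_affine_minorization (mu : probability R R) (f : R -> R) (al be b1 : R) :
  measurable_fun [set: R] f -> (forall u, 0 <= f u) ->
  (forall A : set R, measurable A ->
     mu A = (\int[lebesgue_measure]_(u in A) (f u)%:E)%E) ->
  (forall c : R, exists2 eps : R, 0 < eps & forall u, `|u| <= c -> eps <= f u) ->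
  0 < b1 ->
  exists2 eps, 0 < eps & forall a b : R, `|a| <= al -> b1 <= b <= be ->
    forall h : R -> \bar R, measurable_fun [set: R] h -> (forall v, 0 <= h v)%E ->
    (eps%:E * \int[uniform_unit]_v h v <= \int[mu]_u h (a + b * u)%R)%E.
Proof.
move=> mf f0 muE floc b10.
have [e e0 fe] := floc ((1 + al) / b1).
(* The upper bound [be] carries no sign hypothesis; [|be| + 1] is positive and still dominates
   [b]. *)
exists (e / (`|be| + 1)); first by rewrite divr_gt0// ltr_pwDr.
move=> a b aal /andP[b1b bbe] h mh h0.
have b0 : 0 < b by exact: lt_le_trans b1b.
have be0 : 0 < `|be| + 1 by rewrite ltr_pwDr.
pose aff (u : R) : R := a + b * u.
have maff : measurable_fun [set: R] (aff : R -> R).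
  by apply: measurable_funD => //; apply: measurable_funM.
have eps0 : 0 <= e / (`|be| + 1) by rewrite divr_ge0// ltW.
rewrite (_ : (\int[mu]_u _ = \int[pushforward mu aff]_v h v)%E); last first.
  by rewrite ge0_integral_pushforward.
rewrite -[(e / _)%R]/((NngNum eps0)%:num) -ge0_integral_mscale//.
apply: ge0_le_measure_integral => // S mS.
change ((e / (`|be| + 1))%:E * uniform_unit S <= mu (aff @^-1` S))%E.
rewrite uniform_unitE//.
pose S1 := S `&` `[0, 1]%classic.
have mS1 : measurable S1 by exact: measurableI.
have mpre : measurable (aff @^-1` S1) by rewrite -[X in measurable X]setTI; exact: maff.
apply: (@le_trans _ _ (mu (aff @^-1` S1))); last first.
  apply: le_measure; rewrite ?inE//.
    by rewrite -[X in measurable X]setTI; exact: maff.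
  by apply: preimage_subset; exact: subIsetl.
rewrite muE// (lebesgue_measure_affine a b0 mS1) muleA.
apply: (@le_trans _ _ (e%:E * lebesgue_measure (aff @^-1` S1))%E).
  rewrite lee_wpmul2r// -EFinM lee_fin -mulrA ler_piMr ?(ltW e0)//.
  rewrite mulrC ler_pdivrMr// mul1r (le_trans bbe)//.
  by rewrite (le_trans (ler_norm _))// lerDl.
rewrite -integral_cst//.
apply: ge0_le_integral => //.
- by move=> u _; rewrite lee_fin ltW.
- by apply/measurable_EFinP; exact: measurable_funTS.
move=> u /= [_]; rewrite /= in_itv/= /aff => /andP[u0 u1].
rewrite lee_fin; apply: fe; rewrite ler_pdivlMr//.
apply: (@le_trans _ _ (`|u| * b)); first by rewrite ler_wpM2l.
rewrite -[X in _ * X](gtr0_norm b0) -normrM.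
rewrite (_ : u * b = (a + b * u) - a); last by ring.
by rewrite (le_trans (ler_normB _ _))// lerD// ler_norml u1 andbT (le_trans _ u0).
Qed.

End AffineNoise.

(** * The weight function *)

Section EuclideanNorm.
Context {R : realType} {p : nat}.

Lemma enorm_le_sum (x : 'rV[R]_p) : enorm x <= \sum_(i < p) `|x ord0 i|.
Proof.
rewrite /enorm -[leRHS]ger0_norm ?sumr_ge0// -sqrtr_sqr ler_wsqrtr//.
rewrite [leRHS]expr2 mulr_suml; apply: ler_sum => i _.
rewrite -real_normK ?num_real// expr2 ler_wpM2l// (bigD1 i)//= lerDl.
exact: sumr_ge0.
Qed.

Lemma powR_le_root (t s r : R) : 0 < r -> 0 <= t -> t `^ r <= s -> t <= s `^ r^-1.
Proof.
move=> r0 t0 ts; have tE : t = (t `^ r) `^ r^-1.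
  by rewrite -powRrM divff ?powRr1// gt_eqF.
rewrite [leLHS]tE; apply: ge0_ler_powR => //.
- by rewrite invr_ge0 ltW.
- by rewrite nnegrE powR_ge0.
- by rewrite nnegrE (le_trans _ ts)// powR_ge0.
Qed.

(** Each coordinate is at most the [r]th root of the sum on the right, so the norm is at most [p]
    times that root. No convexity enters, so [r < 1] is covered as well. *)
Lemma enorm_powR_le (x : 'rV[R]_p) (r : R) : 0 < r ->
  enorm x `^ r <= p%:R `^ r * \sum_(i < p) `|x ord0 i| `^ r.
Proof.
move=> r0; set S := \sum_(i < p) _.
have S0 : 0 <= S by apply: sumr_ge0 => i _; exact: powR_ge0.
have xS : enorm x <= p%:R * S `^ r^-1.
  apply: (le_trans (enorm_le_sum x)).
  rewrite -[p in leRHS]card_ord mulr_natl -sumr_const; apply: ler_sum => i _.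
  apply: powR_le_root => //; rewrite /S (bigD1 i)//= lerDl.
  by apply: sumr_ge0 => j _; exact: powR_ge0.
have -> : p%:R `^ r * S = (p%:R * S `^ r^-1) `^ r.
  by rewrite powRM ?powR_ge0// -powRrM mulVf ?gt_eqF// powRr1.
apply: ge0_ler_powR => //; first exact: ltW.
  by rewrite nnegrE sqrtr_ge0.
by rewrite nnegrE mulr_ge0 ?powR_ge0.
Qed.

Lemma measurable_coord (i : 'I_p) :
  measurable_fun [set: Rp R p] (fun x : Rp R p => (x : 'rV[R]_p) ord0 i).
Proof.
by move=> _ B mB; rewrite setTI; apply: sub_sigma_algebra; exists i, B.
Qed.

Lemma measurable_to_Rp d (T : measurableType d) (f : T -> Rp R p) :
  (forall i, measurable_fun [set: T] (fun z => (f z : 'rV[R]_p) ord0 i)) ->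
  measurable_fun [set: T] f.
Proof.
move=> mf; apply: (@measurability _ _ _ _ setT f (@coord_sets R p)) => //.
by move=> _ [_ [i [B [mB ->]]] <-]; exact: mf.
Qed.

Lemma measurable_enorm : measurable_fun [set: Rp R p] (@enorm R p : Rp R p -> R).
Proof.
rewrite (_ : @enorm R p = fun x => (\sum_(i < p) x ord0 i ^+ 2) `^ 2^-1).
  apply: measurableT_comp (measurable_powR _) _.
  apply: measurable_sum => i; apply: measurable_funX; exact: measurable_coord.
by apply/funext => x; rewrite powR12_sqrt// sumr_ge0// => i _; exact: sqr_ge0.
Qed.

End EuclideanNorm.

Section PowerWeight.
Context {R : realType} {p : nat} (hp : (0 < p)%N).
Context (c : 'I_p -> R) (r e : R).
Hypotheses (c_ge0 : forall i, 0 <= c i) (r_gt0 : 0 < r) (e_gt0 : 0 < e).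

(* Tail sums of [c] with a linear correction: by [weightS] the shift of
   coordinates lowers the weighted sum by [c i + e] at the [i]th place. *)
Definition weight (k : nat) : R :=
  \sum_(j < p | (k <= j)%N) c j + e * (p - k)%:R.

Lemma weightS (i : 'I_p) : weight i = c i + e + weight i.+1.
Proof.
rewrite /weight (bigD1 i)//= subnS -[in LHS](prednK (n := p - i)) ?subn_gt0//.
rewrite mulrSr mulrDr mulr1 (eq_bigl (fun j : 'I_p => (i < j)%N)); first by ring.
by move=> j; rewrite ltn_neqAle andbC eq_sym.
Qed.

Lemma weight_last : weight p = 0.
Proof.
rewrite /weight subnn mulr0 addr0 big_pred0// => j.
by rewrite leqNgt ltn_ord.
Qed.

Lemma weight0 : weight 0 = \sum_(j < p) c j + e * p%:R.
Proof. by rewrite /weight subn0. Qed.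

Lemma weight_gt0 (i : 'I_p) : 0 < weight i.
Proof.
rewrite /weight ltr_wpDl ?sumr_ge0// mulr_gt0// ltr0n subn_gt0.
exact: ltn_ord.
Qed.

Lemma weight_le k l : (k <= l)%N -> weight l <= weight k.
Proof.
move=> kl; apply: lerD; last by rewrite ler_wpM2l ?(ltW e_gt0)// ler_nat leq_sub2l.
rewrite [leLHS]big_mkcond [leRHS]big_mkcond; apply: ler_sum => j _.
by case: ifPn => [/(leq_trans kl) ->//|_]; case: ifPn.
Qed.

Definition power_weight (x : 'rV[R]_p) : R :=
  1 + \sum_(i < p) weight i * `|x ord0 i| `^ r.

Lemma weight_term_ge0 (k : nat) (t : R) : (k <= p)%N -> 0 <= weight k * t `^ r.
Proof.
move=> kp; rewrite mulr_ge0 ?powR_ge0// -weight_last; exact: weight_le.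
Qed.

Lemma power_weight_ge1 x : 1 <= power_weight x.
Proof. by rewrite lerDl sumr_ge0// => i _; rewrite weight_term_ge0// ltnW. Qed.

Lemma measurable_power_weight :
  measurable_fun [set: Rp R p] (power_weight : Rp R p -> R).
Proof.
apply: measurable_funD => //; apply: measurable_sum => i.
apply: measurable_funM => //; apply: measurableT_comp (measurable_powR _) _.
by apply: measurableT_comp => //; exact: measurable_coord.
Qed.

Lemma coord_powR_le (x : 'rV[R]_p) (i : 'I_p) :
  `|x ord0 i| `^ r <= (weight i)^-1 * power_weight x.
Proof.
rewrite ler_pdivlMl ?weight_gt0// /power_weight (bigD1 i)//= addrCA lerDl.
by rewrite addr_ge0// sumr_ge0// => j _; rewrite weight_term_ge0// ltnW.
Qed.

(** Every old coordinate moves up one index. The oldest one is dropped, but its term may stay in the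
    sum because its new weight vanishes by [weight_last]. *)
Lemma power_weight_next (a b : 'rV[R]_p -> R) (x : 'rV[R]_p) u :
  power_weight (Defs.next a b x u) = (1 + \sum_(i < p) weight i.+1 * `|x ord0 i| `^ r)
    + weight 0 * `|a x + b x * u| `^ r.
Proof.
rewrite /power_weight -addrA; congr (1 + _).
have := weight_last; move: weight a b x u => w; case: p hp => // q _ a b x u wq.
rewrite big_ord_recl big_ord_recr/= wq mul0r addr0 addrC mxE/=; congr (_ + _).
apply: eq_bigr => i _; rewrite mxE lift0/=; congr (w i.+1 * `|x ord0 _| `^ r).
by apply: val_inj; rewrite /= val_insubd/= (ltn_trans (ltn_ord i)).
Qed.

End PowerWeight.

(** * The autoregressive chain *)

Section AutoregressiveChain.
Context {R : realType} {p : nat} (hp : (0 < p)%N).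
Local Notation vec := 'rV[R]_p.
Implicit Types (a b : vec -> R) (x y : vec).

Lemma measurable_next a b :
  measurable_fun [set: Rp R p] (a : Rp R p -> R) ->
  measurable_fun [set: Rp R p] (b : Rp R p -> R) ->
  measurable_fun [set: (Rp R p * R)%type]
    (fun z => Defs.next a b z.1 z.2 : Rp R p).
Proof.
move=> ma mb; apply: measurable_to_Rp => i.
under eq_fun do rewrite mxE; case: (boolP ((i : nat) == 0%N)) => _ /=.
  apply: measurable_funD; first exact: measurableT_comp ma measurable_fst.
  by apply: measurable_funM => //; exact: measurableT_comp mb measurable_fst.
exact: measurableT_comp (measurable_coord _) measurable_fst.
Qed.

Definition next_mfun a b (ma : measurable_fun [set: Rp R p] (a : Rp R p -> R))
    (mb : measurable_fun [set: Rp R p] (b : Rp R p -> R)) :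
    {mfun (Rp R p * R)%type >-> Rp R p} :=
  HB.pack (fun z : (Rp R p * R)%type => Defs.next a b z.1 z.2 : Rp R p)
    (isMeasurableFun.Build _ _ _ _ _ (measurable_next ma mb)).

(** With location 0 and scale 1 the inserted coordinate is the noise itself. *)
Definition shift_mfun : {mfun (Rp R p * R)%type >-> Rp R p} :=
  next_mfun (@measurable_cst _ _ (Rp R p) R setT 0)
            (@measurable_cst _ _ (Rp R p) R setT 1).

(** Reduces the comparison of the two chains from a fixed state to a comparison of laws on the
    line. *)
Lemma next_shift a b ma mb x u :
  @next_mfun a b ma mb (x, u) = shift_mfun (x, a x + b x * u).
Proof.
by apply/rowP => i; rewrite !mxE/=; case: ifPn => // _; rewrite add0r mul1r.
Qed.

Lemma shift_coord_le (rho : R) x v (i : 'I_p) : 0 <= v <= 1 ->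
  (forall i, `|x ord0 i| <= rho) -> `|(shift_mfun (x, v) : vec) ord0 i| <= Num.max rho 1.
Proof.
move=> /andP[v0 v1] xr; rewrite mxE/=; case: ifPn => _.
  by rewrite add0r mul1r ger0_norm// le_max v1 orbT.
by rewrite le_max xr.
Qed.

(** * Geometric drift of the power weight *)

Section Drift.
Context (c : 'I_p -> R) (r e K : R).
Hypotheses (c_ge0 : forall i, 0 <= c i) (r_gt0 : 0 < r) (e_gt0 : 0 < e)
  (w0 : weight c e 0 = 1).
Let V := power_weight c r e.

(** The coefficient of the [i]th term becomes [weight c e i.+1 + c i], that is [weight c e i - e].
    All weights are at most [weight c e 0 = 1], so this is at most [(1 - e) * weight c e i]. *)
Lemma power_weight_drift (mu : probability R R) a b x :
  (\int[mu]_u (`|a x + b x * u| `^ r)%:E <=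
     (K + \sum_(i < p) c i * `|x ord0 i| `^ r)%:E)%E ->
  (\int[mu]_u (V (Defs.next a b x u))%:E <= ((1 - e) * V x + (`|K| + e))%:E)%E.
Proof.
move=> intK.
set S := 1 + \sum_(i < p) weight c e i.+1 * `|x ord0 i| `^ r.
have S0 : 0 <= S.
  by rewrite addr_ge0// sumr_ge0// => i _; exact: weight_term_ge0.
have maff : measurable_fun [set: R] (fun u => `|a x + b x * u| `^ r).
  apply: measurableT_comp (measurable_powR _) _; apply: measurableT_comp => //.
  by apply: measurable_funD => //; apply: measurable_funM.
under eq_integral do rewrite /V power_weight_next// w0 mul1r EFinD.
rewrite ge0_integralD//; last exact/measurable_EFinP.
rewrite integral_cst// [X in (_ * X)%E](probability_setT mu) mule1.
apply: (le_trans (leeD2l _ intK)); rewrite -EFinD lee_fin.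
have -> : S + (K + \sum_(i < p) c i * `|x ord0 i| `^ r) =
    1 + K + \sum_(i < p) (weight c e i - e) * `|x ord0 i| `^ r.
  rewrite /S addrACA -big_split/=; congr (_ + _); apply: eq_bigr => i _.
  by rewrite (weightS c e i); ring.
have : \sum_(i < p) (weight c e i - e) * `|x ord0 i| `^ r <=
    (1 - e) * \sum_(i < p) weight c e i * `|x ord0 i| `^ r.
  rewrite mulr_sumr; apply: ler_sum => i _; rewrite mulrA ler_wpM2r ?powR_ge0//.
  have := weight_le c_ge0 e_gt0 (leq0n i); rewrite w0 => wi.
  by have := ler_wpM2l (ltW e_gt0) wi; lra.
by have := ler_norm K; rewrite /V /power_weight; lra.
Qed.

Lemma power_weight_growth (mu : probability R R) a b x : e <= 1 ->
  (\int[mu]_u (`|a x + b x * u| `^ r)%:E <=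
     (K + \sum_(i < p) c i * `|x ord0 i| `^ r)%:E)%E ->
  (\int[mu]_u (V (Defs.next a b x u))%:E <= ((1 + `|K|) * V x)%:E)%E.
Proof.
move=> e1 /power_weight_drift/le_trans; apply; rewrite lee_fin.
have V1 : 1 <= V x by exact: power_weight_ge1.
have := ler_wpM2l (addr_ge0 (normr_ge0 K) (ltW e_gt0)) V1.
by rewrite mulr1; lra.
Qed.

End Drift.

(** Gives the comparison chain its own moment bound, so that its operator acts on the same
    weight-bounded functions as that of the true chain. *)
Lemma uniform_moment (r : R) : 0 < r ->
  (\int[uniform_unit]_u (`|0 + 1 * u| `^ r)%:E <= 1%:E)%E.
Proof.
move=> r0; have maff : measurable_fun [set: R] (fun u : R => `|0 + 1 * u| `^ r).
  apply: measurableT_comp (measurable_powR _) _; apply: measurableT_comp => //.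
  by apply: measurable_funD => //; apply: measurable_funM.
rewrite (@uniform_unit_integralE _ (fun u => (`|0 + 1 * u| `^ r)%:E))//;
  last exact/measurable_EFinP.
apply: (@le_trans _ _ (\int[lebesgue_measure]_(v in `[0%R, 1%R]) cst 1%:E v)%E).
  apply: ge0_le_integral => //.
    by apply: measurable_funTS; exact/measurable_EFinP.
  move=> v /=; rewrite in_itv/= => /andP[v0 v1].
  rewrite lee_fin add0r mul1r ger0_norm// -[X in _ <= X](congr1 (@^~ r) (powR1 R)).
  by rewrite ge0_ler_powR ?nnegrE// ltW.
by rewrite integral_cst//= mul1e lebesgue_measure_itv/= lte_fin ltr01 sube0.
Qed.

(** * Minorization on boxes by the chain with uniform noise *)

Section Minorization.
Context (mu : probability R R) (f : R -> R) (a b : vec -> R).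
Context (ma : measurable_fun [set: Rp R p] (a : Rp R p -> R))
  (mb : measurable_fun [set: Rp R p] (b : Rp R p -> R)).
Context (W : Rp R p -> R) (L L' : R).
Hypotheses (mf : measurable_fun [set: R] f) (f_ge0 : forall u, 0 <= f u)
  (mu_density : forall A : set R, measurable A ->
     mu A = (\int[lebesgue_measure]_(u in A) (f u)%:E)%E)
  (f_loc_pos : forall c : R, exists2 eps : R, 0 < eps &
     forall u, `|u| <= c -> eps <= f u)
  (b_loc_bnd : forall c : R, exists C : R, forall x, enorm x <= c -> b x <= C)
  (b_loc_pos : forall c : R, exists2 eps : R, 0 < eps &
     forall x, enorm x <= c -> eps <= b x)
  (a_lin : exists C : R, forall x, `|a x| / (1 + enorm x) <= C).
Let F := next_mfun ma mb.
Hypotheses (mW : measurable_fun [set: Rp R p] W) (W1 : forall x : Rp R p, 1 <= W x)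
  (WL : forall x : Rp R p, (\int[mu]_u (W (F (x, u)))%:E <= (L * W x)%:E)%E)
  (WL' : forall x : Rp R p,
     (\int[uniform_unit]_u (W (shift_mfun (x, u)))%:E <= (L' * W x)%:E)%E).
Let P := transition mu F.
Let Q := transition uniform_unit shift_mfun.
Let PM : markov_operator W P := transition_markov mW W1 WL.
Let QM : markov_operator W Q := transition_markov mW W1 WL'.

Lemma measurable_shift_section (h : Rp R p -> R) x :
  measurable_fun [set: Rp R p] h ->
  measurable_fun [set: R] (fun v => (h (shift_mfun (x, v)))%:E).
Proof.
move=> mh; apply/measurable_EFinP.
exact: measurableT_comp mh (measurable_step shift_mfun x).
Qed.

Lemma next_minorization1 (rho : R) : exists2 eps, 0 < eps &
  forall x, (forall i, `|x ord0 i| <= rho) ->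
  forall h, wbounded W h -> (forall y, 0 <= h y) -> eps * Q h x <= P h x.
Proof.
have [Ca aC] := a_lin.
(* Radius of a Euclidean ball that contains the box. *)
pose N := p%:R * rho.
have [b1 b10 bb1] := b_loc_pos N; have [be bbe] := b_loc_bnd N.
have [eps eps0 min] := density_affine_minorization (`|Ca| * (1 + `|N|)) be mf
  f_ge0 mu_density f_loc_pos b10.
exists eps => // x xr h hW h0.
have xN : enorm x <= N.
  apply: (le_trans (enorm_le_sum x)).
  rewrite /N -[p in p%:R]card_ord mulr_natl -sumr_const.
  exact: ler_sum.
have en0 : 0 <= enorm x by exact: sqrtr_ge0.
have ax : `|a x| <= `|Ca| * (1 + `|N|).
  have := aC x; rewrite ler_pdivrMr ?ltr_pwDl// => /le_trans; apply.
  apply: (@le_trans _ _ (`|Ca| * (1 + enorm x))).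
    by rewrite ler_wpM2r ?ler_norm// addr_ge0.
  by rewrite ler_wpM2l// lerD2l (le_trans xN)// ler_norm.
rewrite -lee_fin EFinM (transitionE mW W1 WL' x hW) (transitionE mW W1 WL x hW).
under [leRHS]eq_integral do rewrite /F next_shift.
apply: (min (a x) (b x) ax _ (fun v => (h (shift_mfun (x, v)))%:E)).
- by rewrite bb1// bbe.
- by apply: measurable_shift_section; case: hW.
- by move=> v; rewrite lee_fin.
Qed.

(** The uniform law charges only the unit interval, so only the values of [h] and [k] on the
    enlarged box count. *)
Lemma shift_monotone (rho : R) x h k : (forall i, `|x ord0 i| <= rho) ->
  wbounded W h -> wbounded W k -> (forall y, 0 <= h y) -> (forall y, 0 <= k y) ->
  (forall y : vec, (forall i, `|y ord0 i| <= Num.max rho 1) -> h y <= k y) ->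
  Q h x <= Q k x.
Proof.
move=> xr hW kW h0 k0 hk.
have mh := measurable_shift_section x hW.1.
have mk := measurable_shift_section x kW.1.
rewrite -lee_fin (transitionE mW W1 WL' x hW) (transitionE mW W1 WL' x kW).
rewrite !uniform_unit_integralE//; try by move=> v; rewrite lee_fin.
apply: ge0_le_integral => //.
- by move=> v _; rewrite lee_fin.
- exact: measurable_funTS mh.
- exact: measurable_funTS mk.
- move=> v /=; rewrite in_itv/= => v01; rewrite lee_fin; apply: hk => i.
  exact: shift_coord_le.
Qed.

(** The outermost step is compared first, at a state in the box; the uniform step then leads to the
    box of size [Num.max rho 1], where the induction hypothesis applies. Hence [rho] varies in the
    induction. *)
Lemma next_minorization n (rho : R) : exists2 eps, 0 < eps &
  forall x, (forall i, `|x ord0 i| <= rho) ->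
  forall g, wbounded W g -> (forall y, 0 <= g y) ->
    eps * iter n Q g x <= iter n P g x.
Proof.
elim: n rho => [|n IH] rho.
  by exists 1 => // x _ g _ _; rewrite mul1r.
have [e1 e10 min1] := next_minorization1 rho.
have [e2 e20 min2] := IH (Num.max rho 1).
exists (e1 * e2) => [|x xr g gW g0]; first exact: mulr_gt0.
have QnM := markov_operator_iter W1 n QM.
have PnM := markov_operator_iter W1 n PM.
have Qn0 y : 0 <= iter n Q g y by case: (QnM.2 y) => _ + _; apply.
have Pn0 y : 0 <= iter n P g y by case: (PnM.2 y) => _ + _; apply.
have QnW := QnM.1 g gW; have PnW := PnM.1 g gW.
apply: (@le_trans _ _ (e1 * Q (iter n P g) x)); last exact: min1.
rewrite -mulrA iterS -(markovZ W1 (QM.2 x))// ler_wpM2l ?(ltW e10)//.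
apply: (shift_monotone xr) => //.
- exact: wboundedZ.
- by move=> y; rewrite mulr_ge0// ltW.
- by move=> y yr; exact: min2.
Qed.

(* For [n = p] the premise is void, so [iter p Q g] is constant: its value is the
   integral of [g] against the minorizing measure. *)
Lemma shift_forget n g x y :
  (forall i : 'I_p, (i + n < p)%N -> x ord0 i = y ord0 i) ->
  iter n Q g x = iter n Q g y.
Proof.
elim: n x y => [|n IH] x y xy.
  by congr g; apply/rowP => i; apply: xy; rewrite addn0.
rewrite !iterS /Q/transition; apply: eq_Rintegral => u _; apply: IH => i inp.
rewrite !mxE/=; case: ifPn => // i0; apply: xy.
rewrite val_insubd (leq_ltn_trans (leq_pred i) (ltn_ord i)).
by rewrite addnS -addSn prednK// lt0n.
Qed.

Lemma small_set_minorization (rho : R) : exists2 eps, 0 < eps &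
  forall x, (forall i, `|x ord0 i| <= rho) ->
  forall g, wbounded W g -> (forall y, 0 <= g y) ->
    eps * iter p Q g 0 <= iter p P g x.
Proof.
have [eps eps0 min] := next_minorization p rho.
exists eps => // x xr g gW g0; rewrite (@shift_forget p g 0 x); first exact: min.
by move=> i; rewrite ltnNge leq_addl.
Qed.

End Minorization.

(** Passes from the extended-real expectations of the statement to the real operator of the
    contraction argument; both put the first step outermost. *)
Lemma cexp_iter (mu : probability R R) a b ma mb (W : Rp R p -> R) (L : R) :
  measurable_fun [set: Rp R p] W -> (forall x : Rp R p, 1 <= W x) ->
  (forall x : Rp R p, (\int[mu]_u (W (@next_mfun a b ma mb (x, u)))%:E <= (L * W x)%:E)%E) ->
  forall g, wbounded W g -> forall n x,
  cexp mu a b n g x = (iter n (transition mu (next_mfun ma mb)) g x)%:E.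
Proof.
move=> mW W1 WL g gW; have PM := transition_markov mW W1 WL.
elim=> [//|n IH] x; rewrite iterS (transitionE mW W1 WL)/=.
  by apply: eq_integral => u _; rewrite IH.
exact: (markov_operator_iter W1 n PM).1.
Qed.

End AutoregressiveChain.

Theorem theorem2p1 (R : realType) (p : nat) (hp : (0 < p)%N)
  (a b : 'rV[R]_p -> R) (mu : probability R R) (f : R -> R)
  (* the model: a, b measurable and finitely piecewise continuous *)
  (ma : measurable_fun [set: Rp R p] (a : Rp R p -> R))
  (mb : measurable_fun [set: Rp R p] (b : Rp R p -> R))
  (pa : piecewise_continuous a) (pb : piecewise_continuous b)
  (* A.1 : e_t has Lebesgue density f, locally bounded away from 0 *)
  (mf : measurable_fun [set: R] f) (f_ge0 : forall u, 0 <= f u)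
  (mu_density : forall A : set R, measurable A ->
     mu A = (\int[lebesgue_measure]_(u in A) (f u)%:E)%E)
  (f_loc_pos : forall c : R, exists2 eps : R, 0 < eps &
     forall u, `|u| <= c -> eps <= f u)
  (* A.1 : b positive, locally bounded and locally bounded away from 0 *)
  (b_pos : forall x, 0 < b x)
  (b_loc_bnd : forall c : R, exists C : R,
     forall x, enorm x <= c -> b x <= C)
  (b_loc_pos : forall c : R, exists2 eps : R, 0 < eps &
     forall x, enorm x <= c -> eps <= b x)
  (* A.2 *)
  (f_bnd : exists C : R, forall u, (1 + `|u|) * f u <= C)
  (e_mom : exists2 r0 : R, 0 < r0 &
     (\int[mu]_u ((`|u| `^ r0)%R)%:E < +oo)%E)
  (* A.3 *)
  (a_lin : exists C : R, forall x, `|a x| / (1 + enorm x) <= C)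
  (b_lin : exists C : R, forall x, `|b x| / (1 + enorm x) <= C)
  (* drift condition *)
  (c : 'I_p -> R) (r K : R)
  (c_ge0 : forall i, 0 <= c i) (c_sum : \sum_(i < p) c i < 1)
  (r_gt0 : 0 < r)
  (drift : forall x : 'rV[R]_p,
     (cexp mu a b 1 (fun y => (`|y ord0 (Ordinal hp)| `^ r)%R) x <=
        (K + \sum_(i < p) c i * `|x ord0 i| `^ r)%R%:E)%E) :
  exists d : 'I_p -> R, (forall i, 0 < d i) /\
    exists Gamma : probability (Rp R p) R,
      V_uniformly_ergodic_with mu a b
        (fun x => 1 + \sum_(i < p) d i * `|x ord0 i| `^ r) Gamma /\
      (\int[Gamma]_x ((enorm x) `^ r)%R%:E < +oo)%E.
Proof.
pose e := (1 - \sum_(i < p) c i) / p%:R.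
have p0 : 0 < p%:R :> R by rewrite ltr0n.
have e0 : 0 < e by rewrite divr_gt0// subr_gt0.
have e1 : e <= 1.
  rewrite ler_pdivrMr// mul1r (@le_trans _ _ 1) ?ler1n//.
  by rewrite gerBl sumr_ge0.
have w0 : weight c e 0 = 1 by rewrite weight0 divfK ?gt_eqF// addrC subrK.
pose V : Rp R p -> R := power_weight c r e.
have mV : measurable_fun [set: Rp R p] V by exact: measurable_power_weight.
have V1 (x : Rp R p) : 1 <= V x by exact: power_weight_ge1.
have drift' x : (\int[mu]_u (`|a x + b x * u| `^ r)%:E <=
    (K + \sum_(i < p) c i * `|x ord0 i| `^ r)%:E)%E.
  apply: le_trans (drift x); rewrite le_eqVlt; apply/orP; left; apply/eqP.
  by apply: eq_integral => u _; rewrite /= mxE.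
pose F := next_mfun ma mb.
have VL (x : Rp R p) :
    (\int[mu]_u (V (F (x, u)))%:E <= ((1 + `|K|) * V x)%:E)%E.
  exact: (@power_weight_growth _ _ hp c r e K).
have VL' (x : Rp R p) : (\int[uniform_unit]_u (V (shift_mfun (x, u)))%:E <=
    ((1 + `|1|) * V x)%:E)%E.
  apply: (@power_weight_growth _ _ hp c r e 1) => //.
  apply: (le_trans (uniform_moment r_gt0)); rewrite lee_fin lerDl.
  by apply: sumr_ge0 => i _; rewrite mulr_ge0 ?powR_ge0.
have PM := transition_markov mV V1 VL.
have QM := transition_markov mV V1 VL'.
have gam01 : 0 <= 1 - e < 1 by apply/andP; split; lra.
have K0 : 0 <= `|K| + e by rewrite addr_ge0// ltW.
have PV (x : Rp R p) : transition mu F V x <= (1 - e) * V x + (`|K| + e).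
  rewrite -lee_fin (transitionE mV V1 VL x (wbounded_weight mV V1)).
  exact: (@power_weight_drift _ _ hp c r e K).
have Pmin R0 : exists2 al, 0 < al & forall (x : Rp R p) g, V x <= R0 ->
    wbounded V g -> (forall y, 0 <= g y) ->
    al * iter p (transition uniform_unit shift_mfun) g 0
      <= iter p (transition mu F) g x.
  (* On [V x <= R0] each coordinate is bounded by its own root; the sum of these roots serves as a
     common bound in place of their maximum. *)
  have [al al0 min] := small_set_minorization mf f_ge0 mu_density f_loc_pos
    b_loc_bnd b_loc_pos a_lin mV V1 VL VL'
    (\sum_(i < p) ((weight c e i)^-1 * R0) `^ r^-1).
  exists al => // x g VR0 gV g0; apply: min => // i.
  apply: (@le_trans _ _ (((weight c e i)^-1 * R0) `^ r^-1)); last first.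
    by rewrite (bigD1 i)//= lerDl sumr_ge0// => j _; exact: powR_ge0.
  apply: powR_le_root => //.
  apply: (le_trans (@coord_powR_le _ _ c r e c_ge0 e0 x i)).
  by rewrite ler_wpM2l// invr_ge0 ltW// weight_gt0.
have [C [rho [C0 rho01 geo]]] := harris_geometric mV V1 PM
  ((markov_operator_iter V1 p QM).2 0) hp gam01 K0 PV Pmin.
have PnV n x : iter n (transition mu F) V x <= V x + (`|K| + e) / (1 - (1 - e)).
  apply: (le_trans (markov_operator_iter_drift mV V1 n PM gam01 PV K0 x)).
  have /andP[gam0 gam1] := gam01.
  rewrite lerD2r ler_piMl//; first exact: le_trans ler01 (V1 x).
  by rewrite exprn_ile1// ltW.
have [G [Gstat GV [M GM]]] := random_iteration_ergodic mV V1 VL C0 rho01 geo PnV.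
have cexpE := cexp_iter mV V1 VL.
exists (fun i => weight c e i); split; first by move=> i; exact: weight_gt0.
exists G; split; last first.
  have : wbounded V (fun x : Rp R p => enorm x `^ r).
    split; first exact: measurableT_comp (measurable_powR _) measurable_enorm.
    exists (p%:R `^ r * \sum_(i < p) (weight c e i)^-1) => x.
    rewrite ger0_norm ?powR_ge0//; apply: (le_trans (enorm_powR_le x r_gt0)).
    rewrite -mulrA ler_wpM2l ?powR_ge0// mulr_suml; apply: ler_sum => i _.
    exact: coord_powR_le.
  by move=> /(wbounded_integrable GV) iE; rewrite -EFin_Rintegral ?ltry.
split.
  move=> A mA; rewrite -Gstat//; apply: eq_integral => x _.
  rewrite cexpE//.
  split; first exact: measurable_indic.
  exists 1 => y; rewrite mul1r ger0_norm; last by rewrite indicE.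
  by apply: le_trans (V1 y); rewrite indicE; case: (_ \in _); rewrite ?ler01.
exists M, rho; split => [|g mg gV n x]; first by case/andP: rho01.
have gW : wbounded V g by split => //; exists 1 => y; rewrite mul1r; exact: gV.
rewrite cexpE// -EFin_Rintegral; last exact: (wbounded_integrable GV gW).
by rewrite -EFinB abse_EFin lee_fin; exact: GM.
Qed.
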